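(* Let $R_n^{(\lambda)}(x)=L_0(I+A)^{-n-\lambda}P_n^{(\lambda)}(x)(I+A)^{\lambda+x}$, whose entries have the form $R_n^{(\lambda)}(x)_{j,k}=\xi_{j,k,n}^{(\lambda)}\,c_{n+j-k}^{(a)}(x)$ for $n+j-k\ge0$ (and $0$ for $n+j-k<0$), with $\xi_{j,k,n}^{(\lambda)}$ independent of $x$. For $1\le j,k\le N$, $n\in\mathbb N_0$, $n+j-k\ge0$, the coefficients $\xi^{(\lambda)}_{j,k,n}$ are given in terms of the dual Hahn polynomials by $$\xi_{j,k,n}^{(\lambda)}=\mathfrak X(j,k,n,\lambda)\times\begin{cases}(1-N)_{k-1}\;{}_3F_2\!\left(\begin{matrix}1-k,\ j-N,\ n+\lambda+1\\ \lambda+1,\ 1-N\end{matrix};1\right)& n+j\ge N,\\[2mm](1-n-j)_{k-1}\;{}_3F_2\!\left(\begin{matrix}1-k,\ -n,\ N-j+\lambda+1\\ \lambda+1,\ 1-n-j\end{matrix};1\right)& n+j<N,\end{cases}$$ $$\phantom{\xi_{j,k,n}^{(\lambda)}}=\mathfrak X(j,k,n,\lambda)\times\begin{cases}(1-N)_{k-1}\,\mathcal R_{k-1}\bigl(\ell(N-j);\lambda,n+j-N,N-1\bigr)&n+j\ge N,\\(1-n-j)_{k-1}\,\mathcal R_{k-1}\bigl(\ell(n);\lambda,N-(n+j),n+j-1\bigr)&n+j<N,\end{cases}$$ with $$\mathfrak X(j,k,n,\lambda)=\sqrt{\frac{(N-k)!}{(N-j)!}}\;\frac{(-1)^{n+j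-1}a^{n+(j-k)/2}(\lambda+n)!\,(N+\lambda-j)!}{(j-1)!\,\lambda!\,(N+\lambda+n-j)!}.$$
   Context: $N\ge1$, $a>0$, $\lambda\in\mathbb N_0=\{0,1,2,\dots\}$; $(z)_j=z(z+1)\cdots(z+j-1)$. $\mu_1,\dots,\mu_N>0$ satisfy $(\mu_j/\mu_k)^2=a^{k-j}\frac{(N-k)!}{(N-j)!}$ and $\delta_k^{(\lambda)}=(a/2)^\lambda\frac{(\lambda+k-1)!}{(k-1)!}$. $A$ is the $N\times N$ matrix whose only nonzero entries are $A_{k+1,k}=\mu_{k+1}/\mu_k=\sqrt{(N-k)/a}$, $1\le k\le N-1$; $T^{(\lambda)}=\mathrm{diag}(\delta_1^{(\lambda)},\dots,\delta_N^{(\lambda)})$; $L_0$ is lower triangular with $(L_0)_{jk}=\frac{\mu_j}{\mu_k}\frac{(-a)^{j-k}}{(j-k)!}$ for $j\ge k$. The weight is $W^{(\lambda)}(x)=\frac{a^x}{x!}(I+A)^{x+\lambda}T^{(\lambda)}(I+A^* )^{x+\lambda}$, $x\in\mathbb N_0$; $(P_n^{(\lambda)})_n$ are the monic matrix polynomials ($\deg P_n^{(\lambda)}=n$) orthogonal with respect to $\langle P,Q\rangle^{(\lambda)}=\sum_{x=0}^\infty P(x)W^{(\lambda)}(x)Q(x)^*$. Since $A$ is nilpotent, $(I+A)^x$ is polynomial in $x$. Scalar Charlier polynomials: $c_n^{(a)}(x)={}_2F_0(-n,-x;-;-1/a)=\sum_{k=0}^n\frac{(-n)_k(-x)_k}{k!}(-1/a)^k$.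 Dual Hahn polynomials: $\mathcal R_k(\ell(x);\gamma,\delta,\mathcal N)={}_3F_2\!\left(\begin{matrix}-k,\,-x,\,x+\gamma+\delta+1\\ \gamma+1,\,-\mathcal N\end{matrix};1\right)$, $k=0,\dots,\mathcal N$, where $\ell(x)=x(x+\gamma+\delta+1)$; ${}_3F_2$ is the (here terminating) hypergeometric series. *)

(* Defs.v *)
From HB Require Import structures.
From mathcomp Require Import all_boot all_order all_algebra.
From mathcomp Require Import spectral complex.
From mathcomp Require Import all_classical all_reals all_analysis.

Set Implicit Arguments.
Unset Strict Implicit.
Unset Printing Implicit Defensive.

Import Order.TTheory GRing.Theory Num.Theory.
Import numFieldNormedType.Exports.

Local Open Scope ring_scope.
Local Open Scope complex_scope.
Local Open Scope sesquilinear_scope.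

(* Scalar functions take the mathematical, 1-based indices j, k = 1, ..., N.
   Matrix entries are indexed by i : 'I_N, which stands for the 1-based index
   i.+1; differences of indices are the same in both conventions. *)

(* Pochhammer symbol (z)_j = z (z + 1) ... (z + j - 1). *)
Definition poch (F : fieldType) (z : F) (j : nat) : F :=
  \prod_(i < j) (z + i%:R).

(* Generalised hypergeometric series. Since 0^-1 = 0, the terms after the first
   zero of a numerator are 0 even if a lower parameter is a nonpositive
   integer, so a terminating series is the usual finite sum (pFq_terminating). *)
Definition pFq (R : realType) (us ls : seq R) (z : R) : R :=
  limn (series (fun i : nat =>
    (\prod_(u <- us) poch u i) / (\prod_(l <- ls) poch l i) / i`!%:R * z ^+ i)).

Definition charlier (F : fieldType) (a : F) (n : nat) (x : F) : F :=
  \sum_(k < n.+1) poch (- n%:R) k * poch (- x) k / k`!%:R * (- a^-1) ^+ k.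

(* The value R_k(l(x); gamma, delta, M), where l(x) = x (x + gamma + delta + 1). *)
Definition dual_hahn (R : realType) (k : nat) (x gamma delta : R) (M : nat) : R :=
  pFq [:: - k%:R; - x; x + gamma + delta + 1] [:: gamma + 1; - M%:R] 1.

Definition gbinom (F : fieldType) (z : F) (i : nat) : F :=
  (\prod_(t < i) (z - t%:R)) / i`!%:R.

(* (I + A)^z for an exponent z in the field and A nilpotent of size N, by the
   binomial series, which stops at A ^+ N = 0. It is polynomial in z. *)
Definition unipow (F : fieldType) (N : nat) (A : 'M[F]_N) (z : F) : 'M[F]_N :=
  \sum_(i < N) gbinom z i *: A ^+ i.

Definition mu_spec (R : realType) (N : nat) (a : R) (mu : 'I_N -> R) : Prop :=
  (forall j, 0 < mu j) /\
  (forall j k : 'I_N, (mu j / mu k) ^+ 2 =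
     a ^ (k%:Z - j%:Z) * ((N - k.+1)`!%:R / (N - j.+1)`!%:R)).

Definition delta (R : realType) (a : R) (lam k : nat) : R :=
  (a / 2) ^+ lam * ((lam + k - 1)`!%:R / (k - 1)`!%:R).

Definition matA (R : realType) (N : nat) (mu : 'I_N -> R) : 'M[R[i]]_N :=
  \matrix_(j, k) if j == k.+1 :> nat then (mu j / mu k)%:C else 0.

Definition matT (R : realType) (N : nat) (a : R) (lam : nat) : 'M[R[i]]_N :=
  diag_mx (\row_(k < N) (delta a lam k.+1)%:C).

Definition matL0 (R : realType) (N : nat) (a : R) (mu : 'I_N -> R) : 'M[R[i]]_N :=
  \matrix_(j, k) if (k <= j)%N
                 then (mu j / mu k * ((- a) ^+ (j - k) / (j - k)`!%:R))%:C
                 else 0.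

Definition weight (R : realType) (N : nat) (a : R) (lam : nat) (mu : 'I_N -> R)
    (x : nat) : 'M[R[i]]_N :=
  (a ^+ x / x`!%:R)%:C *:
    ((1%:M + matA mu) ^+ (x + lam) *m matT N a lam *m
     (1%:M + (matA mu)^t*) ^+ (x + lam)).

(* The series is summed entrywise in R[i]; R[i]^o is R[i] with its topology. *)
Definition inner (R : realType) (N' : nat) (W : nat -> 'M[R[i]]_N'.+1)
    (P Q : {poly 'M[R[i]]_N'.+1}) : 'M[R[i]]_N'.+1 :=
  \matrix_(i, j) limn (series (fun x : nat =>
    (P.[x%:R%:M] *m W x *m (Q.[x%:R%:M])^t*) i j : R[i]^o)).

Definition monic_orthogonal (R : realType) (N' : nat)
    (W : nat -> 'M[R[i]]_N'.+1) (P : nat -> {poly 'M[R[i]]_N'.+1}) : Prop :=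
  (forall n, P n \is monic /\ size (P n) = n.+1) /\
  (forall n m, n != m -> inner W (P n) (P m) = 0).

(* R_n(x) = L_0 (I + A)^(- n - lam) P_n(x) (I + A)^(lam + x). *)
Definition matR (R : realType) (N' : nat) (a : R) (lam : nat)
    (mu : 'I_N'.+1 -> R) (P : nat -> {poly 'M[R[i]]_N'.+1}) (n : nat)
    (x : R[i]) : 'M[R[i]]_N'.+1 :=
  matL0 a mu *m invmx ((1%:M + matA mu) ^+ (n + lam)) *m (P n).[x%:M]
    *m unipow (matA mu) (lam%:R + x).

Definition frakX (R : realType) (a : R) (N j k n lam : nat) : R :=
  Num.sqrt ((N - k)`!%:R / (N - j)`!%:R) *
  (((-1) ^+ (n + j - 1) * a `^ (n%:R + (j%:R - k%:R) / 2) *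
    (lam + n)`!%:R * (N + lam - j)`!%:R) /
   ((j - 1)`!%:R * lam`!%:R * (N + lam + n - j)`!%:R)).

Lemma poch_eq0 (F : fieldType) (m i : nat) :
  (m < i)%N -> poch (- m%:R : F) i = 0.
Proof.
by move=> mi; rewrite /poch (bigD1 (Ordinal mi)) //= addNr mul0r.
Qed.

Lemma pFq_terminating (R : realType) (m : nat) (us ls : seq R) (z : R) :
  - m%:R \in us ->
  pFq us ls z =
  \sum_(i < m.+1)
    (\prod_(u <- us) poch u i) / (\prod_(l <- ls) poch l i) / i`!%:R * z ^+ i.
Proof.
move=> mus; rewrite /pFq; apply: cvg_lim; first exact: Rhausdorff.
apply: cvg_near_cst; exists m.+1 => // n /= mn.
rewrite /series /= -(big_mkord xpredT (fun i : nat =>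
  (\prod_(u <- us) poch u i) / (\prod_(l <- ls) poch l i) / i`!%:R * z ^+ i)).
rewrite (big_cat_nat _ mn) //= [X in _ + X]big1_seq ?addr0//.
move=> i; rewrite mem_index_iota => /andP [_ /andP [mi _]].
by rewrite (big_rem _ mus) /= poch_eq0// !mul0r.
Qed.

Lemma gbinom_nat (F : fieldType) (n i : nat) :
  [pchar F] =i pred0 -> gbinom (n%:R : F) i = 'C(n, i)%:R.
Proof.
move=> charF; have fact_neq0 : i`!%:R != 0 :> F.
  by rewrite ((pcharf0P F).1 charF) -lt0n fact_gt0.
apply: (mulIf fact_neq0); rewrite /gbinom mulfVK// -natrM bin_ffact.
elim: i {fact_neq0} => [|i IHi]; first by rewrite big_ord0 ffactn0.
rewrite big_ord_recr /= IHi ffactnSr natrM.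
have [le_in|lt_ni] := leqP i n; first by rewrite natrB.
by rewrite ffact_small// !mul0r.
Qed.

Lemma matA_nilpotent (R : realType) (N : nat) (mu : 'I_N -> R) :
  matA mu ^+ N = 0.
Proof.
suff H m : forall i j : 'I_N, (i < j + m)%N -> (matA mu ^+ m) i j = 0.
  by apply/matrixP=> i j; rewrite H ?mxE// ltn_addl.
elim: m => [|m IHm] i j ij.
  by rewrite expr0 mxE -val_eqE /= ltn_eqF//; rewrite addn0 in ij.
rewrite exprSr mxE big1// => k _; rewrite [matA mu k j]mxE.
by case: eqP => [kj|]; rewrite ?mulr0// IHm ?mul0r// kj addSnnS.
Qed.

Lemma unipow_nat (R : realType) (N : nat) (mu : 'I_N -> R) (n : nat) :
  unipow (matA mu) n%:R = (1%:M + matA mu) ^+ n.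
Proof.
set A := matA mu.
have An i : (N <= i)%N -> A ^+ i = 0.
  by move=> /subnK <-; rewrite exprD matA_nilpotent mulr0.
have -> : (1%:M + A) ^+ n = \sum_(i < n.+1) A ^+ i *+ 'C(n, i).
  have cA : GRing.comm (1 : 'M[R[i]]_N) A by exact/commr_sym/commr1.
  transitivity ((1 + A) ^+ n); first by [].
  by rewrite (exprDn_comm _ cA); apply: eq_bigr => i _; rewrite expr1n mul1r.
rewrite /unipow (big_ord_widen_cond (N + n.+1) xpredT
  (fun i => gbinom n%:R i *: A ^+ i)) ?leq_addr//.
rewrite (big_ord_widen_cond (N + n.+1) xpredT
  (fun i => A ^+ i *+ 'C(n, i))) ?leq_addl//.
rewrite big_mkcond [RHS]big_mkcond; apply: eq_bigr => i _ /=.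
rewrite gbinom_nat; last exact: pchar_num.
rewrite scaler_nat; case: ltnP => Ni; case: ltnP => ni //.
- by rewrite bin_small.
- by rewrite An// mul0rn.
Qed.

(* Main.v *)
Require Import Defs.
From HB Require Import structures.
From mathcomp Require Import all_boot all_order all_algebra.
From mathcomp Require Import spectral complex.
From mathcomp Require Import all_classical all_reals all_analysis.
From mathcomp Require Import zify ring.

Set Implicit Arguments.
Unset Strict Implicit.
Unset Printing Implicit Defensive.

Import Order.TTheory GRing.Theory Num.Theory.
Import numFieldNormedType.Exports.

Local Open Scope ring_scope.
Local Open Scope complex_scope.
(** The conjugating factors in R_n make everything Toeplitz. Up to the diagonal
    scaling by the mu_j, the matrix A is the nilpotent shift J, so that
    L_0 = exp (- a J), (I + A)^z is the binomial series in J, and the p-th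
    subdiagonal of L_0 (I + A)^y carries C_p(y) / p!, where C_p = (-a)^p c_p is
    the monic Charlier polynomial ([L0_unipow]). Let K(x) be the matrix whose
    entries, up to the scaling, are kappa_jk C_(n+j-k)(x) ([charlier_mx]), the
    constants kappa_jk ([charlier_coef]) being those which the theorem
    predicts. Monic orthogonal polynomials are unique
    ([monic_orthogonal_unique]), so R_n = K follows from two facts.

    First, K(x) (I + A)^(-lam-x) is a polynomial of degree n with leading
    coefficient L_0 (I + A)^(-n-lam) ([polynomial_factor_unipow] and
    [coef_polynomial_factor]). Indeed
      kappa_jk = sum_q gamma_jq / ((n - q)! (j - k + q)!),
    and the q-th term times C_(n+j-k)(x) is gamma_jq times the entry in row
    j + q of the matrix which has C_(d+p)(x) / (d! p!) on its p-th subdiagonal,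
    where d = n - q. The addition rule
      C_(d+p)(x) = sum_i binom(d, i) (-a)^(d-i) x (x-1) ... (x-i+1) C_p(x-i)
    turns that matrix into a combination of the L_0 (I + A)^(x-i) whose
    coefficients are polynomials in x of degree at most d. Only q = 0 reaches
    the degree n.

    Secondly, each entry of K(x) T (I + A')^(x+lam), with A' the adjoint of A,
    is orthogonal to the polynomials of degree less than n for the Poisson
    weight a^x / x! ([charlier_mx_orthogonal]). The test polynomials
    (x+lam+1) ... (x+lam+m) merge with the binomial coefficients which are the
    entries of (I + A')^(x+lam). Summation by parts against C_(n+j-i) then
    reduces all terms of an entry to multiples of one and the same series, and
    the multipliers add up to a finite difference of order k - 1 of a
    polynomial of degree less than k - 1 ([charlier_coef_orth]). This uses a
    second expression of kappa_jk, the alternating sum [dual_hahn_int].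

    That the two expressions agree ([charlier_coefE]) comes from the formula for
    finite differences of binomial coefficients, used twice. The second
    expression is the 3F2 of the case n + j >= N, while the first one is
    symmetric in n and N - j ([charlier_coef_sym]). Exchanging n and N - j in
    the 3F2 therefore gives the case n + j < N. *)

(** * Alternating sums of binomial coefficients *)

(** Pascal's rule read as summation by parts: an alternating binomial sum of
    order K + 1 is one of order K of a first difference. *)
Lemma alternating_sumS (f : nat -> int) K :
  \sum_(t < K.+2) (-1) ^+ t * ('C(K.+1, t)%:R * f t) =
  \sum_(t < K.+1) (-1) ^+ t * ('C(K, t)%:R * (f t - f t.+1)).
Proof.
rewrite big_ord_recl /= expr0 !mul1r.
under eq_bigr => t _ do
  rewrite /bump /= add1n binS natrD mulrDl mulrDr exprS mulN1r.
rewrite big_split /=.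
under [RHS]eq_bigr => t _ do rewrite mulrBr mulrBr.
rewrite sumrB [X in _ + (X + _)]big_ord_recr /= bin_small// mul0r mulr0 addr0.
rewrite [X in _ = X - _]big_ord_recl /= expr0 ?bin0 !mul1r addrA.
congr (_ + _ + _).
  by apply: eq_bigr => t _; rewrite /bump /= add1n exprS mulN1r.
by rewrite -sumrN; apply: eq_bigr => t _; rewrite mulNr.
Qed.

(** Taking the difference of a binomial coefficient in its upper index lowers
    both indices by one. *)
Lemma alternating_sum_bin M X r : (M <= X)%N ->
  \sum_(t < M.+1) (-1) ^+ t * ('C(M, t)%:R * ('C(X - t, r)%:R)) =
  (if (M <= r)%N then 'C(X - M, r - M)%:R else 0) :> int.
Proof.
elim: M X r => [|M IHM] X r MX.
  by rewrite big_ord1 expr0 ?bin0 !mul1r !subn0.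
rewrite (alternating_sumS (fun t => 'C(X - t, r)%:R)).
case: r => [|r].
  by rewrite big1// => t _; rewrite ?bin0 subrr !mulr0.
under eq_bigr => t _.
  have -> : (X - t = (X.-1 - t).+1)%N by have := ltn_ord t; lia.
  have -> : (X - t.+1 = X.-1 - t)%N by lia.
  rewrite binS natrD addrAC subrr add0r.
  over.
rewrite IHM; last by lia.
by rewrite ltnS subSS; have -> : (X.-1 - M = X - M.+1)%N by lia.
Qed.

(** The K-th difference of the function t |-> binom(c+t, d) binom(X-t, e), which
    is a polynomial of degree d + e < K on the range of summation; the bound on
    X keeps the truncated subtraction exact there. *)
Lemma alternating_sum_bin_mul_eq0 K c d X e : (d + e < K)%N -> (K <= X)%N ->
  \sum_(t < K.+1) (-1) ^+ t *
     ('C(K, t)%:R * ('C(c + t, d)%:R * 'C(X - t, e)%:R)) = 0 :> int.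
Proof.
elim: K d e X => [|K IHK] d e X // deK KX.
rewrite (alternating_sumS (fun t => 'C(c + t, d)%:R * 'C(X - t, e)%:R)).
pose S d e := \sum_(t < K.+1) (-1) ^+ t *
     ('C(K, t)%:R * ('C(c + t, d)%:R * 'C(X.-1 - t, e)%:R)) : int.
have S0 d' e' : (d' + e' < K)%N -> S d' e' = 0.
  by move=> ?; apply: IHK => //; lia.
transitivity ((if e is e'.+1 then S d e' else 0) -
              (if d is d'.+1 then S d' e else 0)); last first.
  by case: d deK => [|d]; case: e => [|e] deK; rewrite ?S0 ?subrr//; lia.
rewrite (_ : (if e is e'.+1 then S d e' else 0) =
  \sum_(t < K.+1) (-1) ^+ t * ('C(K, t)%:R * ('C(c + t, d)%:R *
    (if e is e'.+1 then 'C(X.-1 - t, e')%:R else 0)))); last first.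
  by case: (e) => [|//]; rewrite big1// => t _; rewrite !mulr0.
rewrite (_ : (if d is d'.+1 then S d' e else 0) =
  \sum_(t < K.+1) (-1) ^+ t * ('C(K, t)%:R *
    ((if d is d'.+1 then 'C(c + t, d')%:R else 0) * 'C(X.-1 - t, e)%:R)));
  last first.
  by case: (d) => [|//]; rewrite big1// => t _; rewrite mul0r !mulr0.
rewrite -sumrB; apply: eq_bigr => t _; rewrite -!mulrBr; congr (_ * (_ * _)).
have -> : (X - t = (X.-1 - t).+1)%N by have := ltn_ord t; lia.
have -> : (X - t.+1 = X.-1 - t)%N by lia.
rewrite addnS; case: d {deK S0} => [|d]; case: e => [|e];
  rewrite ?bin0 ?binS ?natrD; ring.
Qed.

(** Up to elementary factors, and with 0-based j and k and b = N - 1 - j, this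
    is the dual Hahn polynomial of the case n + j >= N, cleared of denominators:
    see [hypergeometric_dual_hahn_int]. *)
Definition dual_hahn_int (n lam b j k : nat) : int :=
  \sum_(t < k.+1) (-1) ^+ t *
    ('C(k, t)%:R * ('C(n + lam + t, n)%:R * 'C(b + j - t, j)%:R)).

(** Both steps are instances of [alternating_sum_bin]: the first one expands
    binom(n+lam+t, n) along binom(b-t, q); after the products of binomials are
    regrouped, the second one evaluates the sum over t. *)
Lemma dual_hahn_intE n lam b j k : (k <= b + j)%N ->
  dual_hahn_int n lam b j k =
  \sum_(q < b.+1 | (k <= j + q)%N) (-1) ^+ q *
   ('C(j + q, q)%:R * ('C(lam + b + n - q, lam + b)%:R *
     'C(b + j - k, b - q)%:R)).
Proof.
move=> kbj; rewrite /dual_hahn_int.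
have expand (t : nat) : (t <= k)%N ->
  ('C(n + lam + t, n)%:R * 'C(b + j - t, j)%:R = \sum_(q < b.+1) (-1) ^+ q *
   ('C(j + q, q)%:R * ('C(lam + b + n - q, lam + b)%:R *
     'C(b + j - t, j + q)%:R)) :> int).
  move=> tk; have [tb|bt] := leqP t b; last first.
    rewrite ['C(_, j)]bin_small ?mulr0; last by lia.
    by rewrite big1// => q _; rewrite ['C(_, j + q)]bin_small ?mulr0//; lia.
  (* This expansion needs t <= b; for t > b both sides vanish. *)
  have -> : 'C(n + lam + t, n)%:R = \sum_(q < (b - t).+1) (-1) ^+ q *
      ('C(b - t, q)%:R * 'C(lam + b + n - q, lam + b)%:R) :> int.
    rewrite alternating_sum_bin; last by lia.
    rewrite ifT; last by lia.
    have -> : (lam + b + n - (b - t) = n + lam + t)%N by lia.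
    have -> : (lam + b - (b - t) = lam + t)%N by lia.
    by rewrite -bin_sub; [congr (('C(_, _))%:R)|]; lia.
  rewrite (big_ord_widen b.+1 (fun q => (-1) ^+ q *
      ('C(b - t, q)%:R * 'C(lam + b + n - q, lam + b)%:R : int))); last by lia.
  rewrite big_mkcond mulr_suml; apply: eq_bigr => q _ /=.
  case: ltnP => qbt; last first.
    by rewrite ['C(_, j + q)]bin_small ?mulr0 ?mul0r//; lia.
  suff -> : ('C(j + q, q)%:R * ('C(lam + b + n - q, lam + b)%:R *
    'C(b + j - t, j + q)%:R)
    = 'C(lam + b + n - q, lam + b)%:R *
      ('C(j + q, q) * 'C(b + j - t, j + q))%N%:R :> int).
    suff -> : ('C(j + q, q) * 'C(b + j - t, j + q) =
      'C(b - t, q) * 'C(b + j - t, j))%N.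
      by rewrite natrM; ring.
    apply/eqP; rewrite -(eqn_pmul2r (fact_gt0 j)) -(eqn_pmul2r (fact_gt0 q)).
    rewrite -(eqn_pmul2r (fact_gt0 (b - t - q))); apply/eqP.
    have := @bin_fact (j + q) q ltac:(lia).
    have := @bin_fact (b + j - t) (j + q) ltac:(lia).
    have := @bin_fact (b - t) q ltac:(lia).
    have := @bin_fact (b + j - t) j ltac:(lia).
    have -> : (j + q - q = j)%N by lia.
    have -> : (b + j - t - (j + q) = b - t - q)%N by lia.
    have -> : (b + j - t - j = b - t)%N by lia.
    move: ('C(j + q, q)) ('C(b + j - t, j + q)) ('C(b - t, q))
      ('C(b + j - t, j)) => c1 c2 c3 c4.
    move=> e4 e3 e2 e1.
    transitivity (b + j - t)`!.
      by rewrite -e2 -e1; ring.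
    by rewrite -e4 -e3; ring.
  by rewrite natrM; ring.
under eq_bigr => t _ do rewrite expand ?leq_ord// mulr_sumr mulr_sumr.
rewrite exchange_big [RHS]big_mkcond; apply: eq_bigr => q _ /=.
transitivity (((-1) ^+ q * ('C(j + q, q)%:R * 'C(lam + b + n - q, lam + b)%:R))
  *
  \sum_(t < k.+1) (-1) ^+ t * ('C(k, t)%:R * 'C(b + j - t, j + q)%:R : int)).
  by rewrite mulr_sumr; apply: eq_bigr => t _; ring.
rewrite alternating_sum_bin//; case: ifP => kjq; last by rewrite mulr0.
have -> : 'C(b + j - k, j + q - k) = 'C(b + j - k, b - q).
  by rewrite -bin_sub; [congr 'C(_, _)|]; have := ltn_ord q; lia.
by ring.
Qed.
(** The Vandermonde convolution on upper indices. The hypothesis p <= r says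
    that no nonzero term of the full convolution has been left out. *)
Lemma sum_bin_convolution p r k m : (p <= r)%N ->
  (\sum_(i < k.+1) 'C(p + i, r) * 'C(k - i + m, m) =
    'C(p + k + m.+1, r + m.+1))%N.
Proof.
move=> pr; elim: m k => [|m IHm]; elim=> [|k IHk].
- rewrite big_ord1 bin0 muln1 !addn0 !addn1 binS.
  by rewrite [X in _ = (X + _)%N]bin_small.
- under eq_bigr => i _ do rewrite bin0 muln1.
  rewrite big_ord_recr /= addn1 !addnS addn0 binS; congr (_ + _)%N.
  transitivity 'C(p + k + 1, r + 1); last by rewrite !addn1 ?addnS.
  by rewrite -IHk; apply: eq_bigr => i _; rewrite bin0 muln1.
- move: (IHm 0); rewrite !big_ord1 /= !addn0 !sub0n !add0n !binn !muln1 => ->.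
  have e : 'C((p + m).+1, (r + m).+2) = 0%N by rewrite bin_small//; lia.
  by rewrite !addnS [RHS]binS e.
- have := IHm k.+1; have := IHk.
  rewrite [in X in _ -> X -> _]big_ord_recr /= subnn add0n binn muln1 => e1 e2.
  rewrite big_ord_recr /= subnn add0n binn muln1.
  have -> : (p + k.+1 + m.+2 = (p + k.+1 + m.+1).+1)%N by lia.
  have -> : (r + m.+2 = (r + m.+1).+1)%N by lia.
  rewrite binS -e2.
  have -> : (p + k.+1 + m.+1 = p + k + m.+2)%N by lia.
  have -> : ((r + m.+1).+1 = r + m.+2)%N by lia.
  rewrite -e1 addnA -big_split /=; congr (_ + _)%N.
  apply: eq_bigr => i _; rewrite -mulnDr; congr (_ * _)%N.
  rewrite subSn ?leq_ord// addSn binS addnS addSn; congr addn.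
Qed.

(** After exchanging the sums, the convolution rule leaves an alternating sum
    over t of a ratio of factorials, which is a polynomial in t of degree n - m
    - 1, times binom(b+j-t, j). The condition n + j <= k + m says exactly that
    the total degree is less than k. *)
Lemma dual_hahn_int_orth n lam b j k m :
  (m < n)%N -> (n + j <= k + m)%N -> (k <= b + j)%N ->
  \sum_(i < k.+1) dual_hahn_int n lam b j i *
     ('C(lam + i, i) * 'C(k - i + m, m))%:R = 0.
Proof.
move=> mn njkm kbj.
transitivity (\sum_(t < k.+1) (-1) ^+ t *
   ('C(n + lam + t, n)%:R * 'C(b + j - t, j)%:R *
     ('C(lam + t, t) * 'C(lam + k + m.+1, lam + t + m.+1))%:R) : int).
  rewrite /dual_hahn_int.
  under eq_bigr => i _.
    rewrite (big_ord_widen k.+1 (fun t => (-1) ^+ t *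
      ('C(i, t)%:R * ('C(n + lam + t, n)%:R * 'C(b + j - t, j)%:R : int)))) //.
    rewrite big_mkcond mulr_suml; over.
  rewrite exchange_big; apply: eq_bigr => t _ /=.
  rewrite -sum_bin_convolution ?leq_addr// big_distrr /= natr_sum.
  rewrite !mulr_sumr; apply: eq_bigr => i _; rewrite ltnS.
  case: leqP => ti; last first.
    by rewrite ['C(lam + i, lam + t)]bin_small ?mul0n ?muln0 ?mulr0 ?mul0r//;
      lia.
  suff e : ('C(i, t) * 'C(lam + i, i) =
    'C(lam + t, t) * 'C(lam + i, lam + t))%N.
    by rewrite mulnA -e !natrM; ring.
  apply/eqP; rewrite -(eqn_pmul2r (fact_gt0 (i - t)))
    -(eqn_pmul2r (fact_gt0 t)).
  rewrite -(eqn_pmul2r (fact_gt0 lam)); apply/eqP.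
  have := bin_fact ti; have := @bin_fact (lam + i) i ltac:(lia).
  have := @bin_fact (lam + t) t ltac:(lia).
  have := @bin_fact (lam + i) (lam + t) ltac:(lia).
  rewrite !addnK subnDl => e4 e3 e2 e1.
  transitivity (lam + i)`!; first by rewrite -e2 -e1; ring.
  by rewrite -e4 -e3; ring.
(* The factorials that do not depend on t are cleared first. *)
have nz : (n`! * lam`! * k`!)%:R != 0 :> int.
  by rewrite pnatr_eq0 !muln_eq0 !negb_or -!lt0n !fact_gt0.
apply: (mulfI nz); rewrite mulr0 mulr_sumr.
transitivity (((lam + k + m.+1)`! * (n - m.+1)`!)%:R *
  \sum_(t < k.+1) (-1) ^+ t *
     ('C(k, t)%:R * ('C(n + lam + t, n - m.+1)%:R * 'C(b + j - t, j)%:R)) :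
       int);
  last by rewrite alternating_sum_bin_mul_eq0 ?mulr0//; lia.
rewrite mulr_sumr; apply: eq_bigr => -[t /= tk] _.
suff e : (n`! * lam`! * k`! * ('C(n + lam + t, n) *
      ('C(lam + t, t) * 'C(lam + k + m.+1, lam + t + m.+1))) =
    (lam + k + m.+1)`! * (n - m.+1)`! *
      ('C(k, t) * 'C(n + lam + t, n - m.+1)))%N.
  transitivity ((-1) ^+ t * 'C(b + j - t, j)%:R *
    (n`! * lam`! * k`! * ('C(n + lam + t, n) *
      ('C(lam + t, t) * 'C(lam + k + m.+1, lam + t + m.+1))))%N%:R : int).
    by rewrite !natrM; ring.
  by rewrite e !natrM; ring.
apply/eqP; rewrite -(eqn_pmul2r (fact_gt0 (lam + t)))
  -(eqn_pmul2r (fact_gt0 t)).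
rewrite -(eqn_pmul2r (fact_gt0 (lam + t + m.+1))).
rewrite -(eqn_pmul2r (fact_gt0 (k - t))); apply/eqP.
have := @bin_fact (n + lam + t) n ltac:(lia).
have := @bin_fact (lam + t) t ltac:(lia).
have := @bin_fact (lam + k + m.+1) (lam + t + m.+1) ltac:(lia).
have := @bin_fact k t ltac:(lia).
have := @bin_fact (n + lam + t) (n - m.+1) ltac:(lia).
have -> : (n + lam + t - n = lam + t)%N by lia.
have -> : (lam + k + m.+1 - (lam + t + m.+1) = k - t)%N by lia.
have -> : (n + lam + t - (n - m.+1) = lam + t + m.+1)%N by lia.
rewrite addnK => e5 e4 e3 e2 e1.
transitivity ((n + lam + t)`! * (lam + t)`! * (lam + k + m.+1)`! * k`!)%N.
  by symmetry; rewrite -{1}e1 -{1}e2 -{1}e3; ring.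
by rewrite -e5 -{1}e4; ring.
Qed.

(** * The coefficients of the Charlier polynomials *)

Section CharlierCoefficients.
Variable F : numFieldType.

(** The coefficient gamma_jq in the header: the weight with which row j + q
    contributes to row j in [charlier_mx]. *)
Definition shift_coef (n lam b j q : nat) : F :=
  (-1) ^+ q * ('C(j + q, q) * n`! * b`! * (lam + b + n - q)`!)%:R /
  ((b - q)`! * (lam + b + n)`!)%:R.

Definition charlier_coef (n lam b j k : nat) : F :=
  \sum_(q < n.+1 | (q <= b)%N && (k <= j + q)%N)
    shift_coef n lam b j q / ((n - q)`! * (j + q - k)`!)%:R.

Lemma natf_neq0 n : (0 < n)%N -> n%:R != 0 :> F.
Proof. by rewrite pnatr_eq0 lt0n. Qed.

Lemma factf_neq0 n : n`!%:R != 0 :> F.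
Proof. by rewrite natf_neq0// fact_gt0. Qed.

Lemma charlier_coef_eq0 n lam b j k : (n + j < k)%N ->
  charlier_coef n lam b j k = 0.
Proof.
by move=> njk; rewrite /charlier_coef big_pred0// => q; have := ltn_ord q; lia.
Qed.

(** This symmetry, obvious on the defining sum, accounts for the two cases of
    the theorem. *)
Lemma charlier_coef_sym n lam b j k : charlier_coef n lam b j k =
  charlier_coef b lam n j k.
Proof.
rewrite /charlier_coef.
pose f n b q := shift_coef n lam b j q / ((n - q)`! * (j + q - k)`!)%:R.
rewrite (big_ord_widen_cond (n + b).+1
  (fun q => (q <= b)%N && (k <= j + q)%N) (f n b)) ?ltnS ?leq_addr//.
rewrite [RHS](big_ord_widen_cond (n + b).+1
  (fun q => (q <= n)%N && (k <= j + q)%N) (f b n)) ?ltnS ?leq_addl//.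
apply: eq_big => [q|q _]; first by rewrite !ltnS [LHS]andbC [RHS]andbC andbCA
  andbC.
rewrite /f /shift_coef; have -> : (lam + n + b = lam + b + n)%N by lia.
rewrite !natrM; field.
by rewrite !factf_neq0.
Qed.

Lemma charlier_coefE n lam b j k : (k <= b + j)%N ->
  charlier_coef n lam b j k =
  ((lam + b)`! * b`! * n`!)%:R / ((lam + b + n)`! * (b + j - k)`!)%:R *
  (dual_hahn_int n lam b j k)%:~R.
Proof.
move=> kbj; rewrite dual_hahn_intE// rmorph_sum mulr_sumr /charlier_coef.
pose f q := shift_coef n lam b j q / ((n - q)`! * (j + q - k)`!)%:R.
rewrite (big_ord_widen_cond (n + b).+1
  (fun q => (q <= b)%N && (k <= j + q)%N) f) ?ltnS ?leq_addr//.
pose g q : F := ((lam + b)`! * b`! * n`!)%:R /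
  ((lam + b + n)`! * (b + j - k)`!)%:R *
 ((-1) ^+ q *
   ('C(j + q, q)%:R * ('C(lam + b + n - q, lam + b)%:R *
     'C(b + j - k, b - q)%:R))).
transitivity (\sum_(q < b.+1 | (k <= j + q)%N) g q); last first.
  by apply: eq_bigr => q _; rewrite /g !rmorphM /= rmorphXn /=
    rmorphN1 !mulrz_nat.
rewrite [RHS](big_ord_widen_cond (n + b).+1
  (fun q => (k <= j + q)%N) g) ?ltnS ?leq_addl//.
rewrite [LHS]big_mkcond [RHS]big_mkcond; apply: eq_bigr => -[q /= _] _.
rewrite !ltnS; case: (leqP k (j + q)) => kjq; rewrite ?andbF//= !andbT.
case: leqP => qb //=; case: leqP => qn.
  rewrite /f /shift_coef /g !natrM.
  have := @bin_fact (lam + b + n - q) (lam + b) ltac:(lia).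
  have := @bin_fact (b + j - k) (b - q) ltac:(lia).
  have -> : (lam + b + n - q - (lam + b) = n - q)%N by lia.
  have -> : (b + j - k - (b - q) = j + q - k)%N by lia.
  by move=> <- <-; rewrite !natrM; field; rewrite !factf_neq0 natf_neq0//
    bin_gt0; lia.
by rewrite /g ['C(_, lam + b)]bin_small ?mul0r ?mulr0//; lia.
Qed.

(** The orthogonality relation between the coefficients in one row. The
    factorials come from the diagonal part of the weight and from the test
    polynomials; the factor (b + j - i)! cancels the denominator in
    [charlier_coefE]. *)
Lemma charlier_coef_orth n lam b j k m :
  (m < n)%N -> (n + j <= k + m)%N -> (k <= b + j)%N ->
  \sum_(i < k.+1) charlier_coef n lam b j i *
     ((lam + i)`! * (b + j - i)`! * (k - i + m)`!)%:R / (i`! * (k - i)`!)%:R =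
       0.
Proof.
move=> mn njkm kbj.
transitivity (((lam + b)`! * b`! * n`! * lam`! * m`!)%:R / ((lam + b + n)`!)%:R
  *
  (\sum_(i < k.+1) dual_hahn_int n lam b j i *
     ('C(lam + i, i) * 'C(k - i + m, m))%:R)%:~R : F); last first.
  by rewrite dual_hahn_int_orth// mulr0.
rewrite rmorph_sum mulr_sumr; apply: eq_bigr => -[i /= ik] _.
rewrite charlier_coefE; last by lia.
rewrite intrM mulrz_nat !natrM.
have := @bin_fact (lam + i) i ltac:(lia).
have := @bin_fact (k - i + m) m ltac:(lia).
rewrite !addnK => <- <-; rewrite !natrM; field.
by rewrite !factf_neq0.
Qed.

End CharlierCoefficients.

(** * The hypergeometric form of the coefficients *)

Section Hypergeometric.
Variable F : numFieldType.

Lemma poch_oppn (m i : nat) : poch (- m%:R) i = (-1) ^+ i * (m ^_ i)%:R :> F.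
Proof.
elim: i => [|i IHi]; first by rewrite /poch big_ord0 ffactn0 mul1r.
rewrite /poch big_ord_recr /= -/(poch _ i) IHi ffactnSr exprS.
have [im|mi] := leqP i m; first by rewrite natrM natrB//; ring.
by rewrite ffact_small// mul0n !(mulr0, mul0r).
Qed.

Lemma poch_natS (m i : nat) : poch (m%:R + 1) i = (m + i)`!%:R / m`!%:R :> F.
Proof.
elim: i => [|i IHi]; first by rewrite /poch big_ord0 addn0 divff// factf_neq0.
rewrite /poch big_ord_recr /= -/(poch _ i) IHi addnS factS natrM
  -[(m + i).+1]addn1.
by rewrite !natrD; field; rewrite factf_neq0.
Qed.

Lemma hypergeometric_dual_hahn_int n lam b j k : (k <= b + j)%N ->
  poch (- (b + j)%:R : F) k *
  \sum_(i < k.+1)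
    poch (- k%:R) i * (poch (- b%:R) i * poch ((n + lam)%:R + 1) i) /
    (poch (lam%:R + 1) i * poch (- (b + j)%:R) i) / i`!%:R =
  (-1) ^+ k * (lam`! * j`! * b`! * n`!)%:R / ((n + lam)`! * (b + j - k)`!)%:R *
  (dual_hahn_int n lam b j k)%:~R.
Proof.
move=> kbj; rewrite /dual_hahn_int rmorph_sum !mulr_sumr.
apply: eq_bigr => -[i /= ik] _.
rewrite !intrM !mulrz_nat rmorphXn /= rmorphN1 !poch_oppn !poch_natS.
have [ib|bi] := leqP i b; last first.
  by rewrite [(b ^_ i)%N]ffact_small//
    ['C(b + j - i, j)]bin_small ?(mul0r, mulr0)//; lia.
have := @bin_fact (n + lam + i) n ltac:(lia).
have := @bin_fact (b + j - i) j ltac:(lia).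
have -> : (n + lam + i - n = lam + i)%N by lia.
have -> : (b + j - i - j = b - i)%N by lia.
have ffE m p : (p <= m)%N -> (m ^_ p)%:R = m`!%:R / (m - p)`!%:R :> F.
  by move=> pm; rewrite -(ffact_fact pm) natrM mulfK// factf_neq0.
move=> e1 e2; rewrite -(bin_ffact k i) -e2 !ffE//; [|lia..].
rewrite -e1 !natrM; field.
by rewrite !factf_neq0 signr_eq0 pnatr_eq0 -lt0n bin_gt0 /=; lia.
Qed.
End Hypergeometric.

Section Coefficients.
Variable R : realType.
Implicit Types a : R.

(** The coefficients xi_(j,k,n) of the theorem, for 1-based j and k. *)
Definition xi_of (a : R) (N lam j k n : nat) : R :=
  frakX a N j k n lam *
  (if (N <= n + j)%N
   then poch (1 - N%:R) (k - 1) *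
        pFq [:: 1 - k%:R; j%:R - N%:R; n%:R + lam%:R + 1]
            [:: lam%:R + 1; 1 - N%:R] 1
   else poch (1 - n%:R - j%:R) (k - 1) *
        pFq [:: 1 - k%:R; - n%:R; N%:R - j%:R + lam%:R + 1]
            [:: lam%:R + 1; 1 - n%:R - j%:R] 1).

Lemma xi_of_dual_hahn a N lam j k n :
  (1 <= j <= N)%N -> (1 <= k <= N)%N -> (k <= n + j)%N ->
  xi_of a N lam j k n =
  frakX a N j k n lam *
  (if (N <= n + j)%N
   then poch (1 - N%:R) (k - 1) *
        dual_hahn (k - 1) (N%:R - j%:R) lam%:R (n%:R + j%:R - N%:R) (N - 1)
   else poch (1 - n%:R - j%:R) (k - 1) *
        dual_hahn (k - 1) n%:R lam%:R (N%:R - (n%:R + j%:R)) (n + j - 1)).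
Proof.
move=> /andP[j1 jN] /andP[k1 kN] knj.
rewrite /xi_of /dual_hahn !natrB ?natrD; [|lia..].
have -> : N%:R - j%:R + lam%:R + (n%:R + j%:R - N%:R) + 1 =
  n%:R + lam%:R + 1 :> R.
  by ring.
have -> : n%:R + lam%:R + (N%:R - (n%:R + j%:R)) + 1 =
  N%:R - j%:R + lam%:R + 1 :> R.
  by ring.
by rewrite !opprB [- (n%:R + j%:R)]opprD [1 + (_ + _)]addrA.
Qed.

Lemma poch_pFq_dual_hahn_int n lam b j k : (k <= b + j)%N ->
  poch (- (b + j)%:R : R) k *
  pFq [:: - k%:R; - b%:R; (n + lam)%:R + 1] [:: lam%:R + 1; - (b + j)%:R] 1 =
  (-1) ^+ k * (lam`! * j`! * b`! * n`!)%:R / ((n + lam)`! * (b + j - k)`!)%:R *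
  (dual_hahn_int n lam b j k)%:~R.
Proof.
move=> kbj; rewrite -hypergeometric_dual_hahn_int// (@pFq_terminating _ k).
  congr (_ * _); apply: eq_bigr => i _.
  by rewrite !big_cons !big_nil expr1n !mulr1.
by rewrite inE eqxx.
Qed.

(** For n + j >= N the 3F2 amounts to [dual_hahn_int] with parameters n and N -
    j; otherwise it is the same sum with these two exchanged, and
    [charlier_coef_sym] applies. *)
Lemma xi_of_charlier_coef a N' lam j k n : (j <= N')%N -> (k <= N')%N ->
  (k <= n + j)%N ->
  xi_of a N'.+1 lam j.+1 k.+1 n =
  Num.sqrt ((N' - k)`!%:R / (N' - j)`!%:R) *
  a `^ (n%:R + (j%:R - k%:R) / 2) * (-1) ^+ (n + j + k) *
  charlier_coef R n lam (N' - j) j k.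
Proof.
move=> jN kN knj; rewrite /xi_of /frakX.
have -> : (n + j.+1 - 1 = n + j)%N by lia.
have -> : (N'.+1 + lam - j.+1 = lam + (N' - j))%N by lia.
have -> : (N'.+1 + lam + n - j.+1 = lam + (N' - j) + n)%N by lia.
have -> : (j.+1%:R - k.+1%:R = j%:R - k%:R :> R) by rewrite -!natr1; ring.
set b := (N' - j)%N; have bj : (b + j = N')%N by rewrite /b; lia.
have e1 : 1 - N'.+1%:R = - (b + j)%:R :> R by rewrite bj -natr1; ring.
have e2 : 1 - k.+1%:R = - k%:R :> R by rewrite -natr1; ring.
have e3 : j.+1%:R - N'.+1%:R = - b%:R :> R by rewrite -bj -!natr1 natrD; ring.
have e4 : 1 - n%:R - j.+1%:R = - (n + j)%:R :> R by rewrite -natr1 natrD; ring.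
have e5 : N'.+1%:R - j.+1%:R + lam%:R = (b + lam)%:R :> R.
  by rewrite -bj -!natr1 !natrD; ring.
rewrite !subSS !subn0 -/b e1 e2 e3 e4 e5 -[n%:R + lam%:R]natrD.
rewrite 2?poch_pFq_dual_hahn_int//; last by rewrite bj.
case: ifP => _.
  rewrite charlier_coefE ?bj// [(n + lam)%N]addnC !natrM.
  by rewrite !exprD; field; rewrite !factf_neq0.
rewrite charlier_coef_sym charlier_coefE// [(b + lam)%N]addnC !natrM.
have -> : (lam + n + b = lam + b + n)%N by lia.
by rewrite !exprD; field; rewrite !factf_neq0.
Qed.

Lemma sqrt_powR_mu_ratio a N' (mu : 'I_N'.+1 -> R) (j k : 'I_N'.+1) n :
  0 < a -> mu_spec a mu -> (k <= n + j)%N ->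
  Num.sqrt ((N' - k)`!%:R / (N' - j)`!%:R) * a `^ (n%:R + (j%:R - k%:R) / 2) =
  mu j / mu k * a ^+ (n + j - k).
Proof.
move=> a0 [mu0 muE] knj; have an0 : a != 0 by rewrite gt_eqF.
have fr0 : 0 <= (N' - k)`!%:R / (N' - j)`!%:R :> R by rewrite divr_ge0.
(* Both sides are nonnegative, and their squares are rational in a. *)
apply: (@pexpIrn _ 2) => //; rewrite ?nnegrE.
- by rewrite mulr_ge0 ?sqrtr_ge0 ?powR_ge0.
- by rewrite mulr_ge0 ?exprn_ge0 ?divr_ge0 ?ltW.
rewrite exprMn sqr_sqrtr// [RHS]exprMn muE !subSS -(powR_mulrn 2 (powR_ge0 _ _))
  -powRrM.
have -> : (n%:R + (j%:R - k%:R) / 2) * 2%:R = (n + n + j)%:R - k%:R :> R.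
  by rewrite !natrD; field.
rewrite powRD ?an0 ?implybT// powRN !powR_mulrn ?ltW//.
have -> : a ^+ (n + j - k) = a ^+ (n + j) / a ^+ k.
  by apply: (canRL (mulfK _)); rewrite ?expf_neq0// -exprD subnK.
rewrite expfzDr// -exprnN -exprnP !exprD; field.
by rewrite !expf_neq0//= !factf_neq0.
Qed.

End Coefficients.

(** * Monic Charlier polynomials *)

Section MonicCharlier.
Variable F : numFieldType.
Implicit Types (a x z : F) (f : F -> F).

Definition falling x (i : nat) : F := \prod_(t < i) (x - t%:R).

Lemma fallingS x i : falling x i.+1 = falling x i * (x - i%:R).
Proof. by rewrite /falling big_ord_recr. Qed.

Lemma falling_recl x i : falling x i.+1 = x * falling (x - 1) i.
Proof.
rewrite /falling big_ord_recl /= subr0; congr (_ * _).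
by apply: eq_bigr => t _; rewrite /bump /= add1n -natr1; ring.
Qed.

Lemma gbinomE z i : gbinom z i = falling z i / i`!%:R.
Proof. by []. Qed.

Lemma gbinom_pascal z i : gbinom (z + 1) i.+1 = gbinom z i + gbinom z i.+1.
Proof.
rewrite !gbinomE falling_recl addrK fallingS factS natrM.
by field; rewrite factf_neq0 [1 + _]addrC natr1 pnatr_eq0.
Qed.

(** The raising operator of the monic Charlier polynomials, which is the adjoint
    of a times the forward difference for the Poisson weight
    ([poisson_sum_mcharlierS]). *)
Definition charlier_raise a f x : F := x * f (x - 1) - a * f x.

Definition mcharlier a (n : nat) : F -> F :=
  iter n (charlier_raise a) (fun=> 1).

(** The operator is the sum of f |-> x f(x - 1) and of a scalar, which commute,
    so its powers are given by the binomial theorem. *)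
Lemma iter_charlier_raise a n f x :
  iter n (charlier_raise a) f x =
  \sum_(i < n.+1) 'C(n, i)%:R * (- a) ^+ (n - i) * falling x i * f (x - i%:R).
Proof.
elim: n x => [|n IHn] x.
  by rewrite big_ord1 /= /falling big_ord0 subr0 !mul1r.
rewrite iterS /charlier_raise !IHn [RHS]big_ord_recl /=.
under [in RHS]eq_bigr => i _ do
  rewrite /bump /= add1n binS subSS natrD !mulrDl.
rewrite big_split /= [RHS]addrA [RHS]addrC; congr (_ + _).
  rewrite mulr_sumr; apply: eq_bigr => i _.
  rewrite falling_recl -addrA -opprD -[i.+1%:R]natr1 [1 + _]addrC; ring.
rewrite [X in _ = _ + X]big_ord_recr /= (@bin_small n n.+1)//
  !mul0r addr0 !mulr_sumr -sumrN.
rewrite big_ord_recl /= !bin0 !subn0 exprS; congr (_ + _); first by ring.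
apply: eq_bigr => i _; rewrite /bump /= add1n.
have -> : (n - i = (n - i.+1).+1)%N by have := ltn_ord i; lia.
by rewrite exprS; ring.
Qed.

Lemma mcharlierD a d p x :
  mcharlier a (d + p) x =
  \sum_(i < d.+1) 'C(d, i)%:R * (- a) ^+ (d - i) * falling x i *
    mcharlier a p (x - i%:R).
Proof. by rewrite /mcharlier iterD iter_charlier_raise. Qed.

Lemma mcharlierE a n x :
  mcharlier a n x = \sum_(i < n.+1) 'C(n, i)%:R * (- a) ^+ (n - i) * falling x
    i.
Proof.
by rewrite /mcharlier iter_charlier_raise; apply: eq_bigr => i _; rewrite mulr1.
Qed.

Lemma mcharlier_charlier a n x : a != 0 ->
  mcharlier a n x = (- a) ^+ n * charlier a n x.
Proof.
move=> a0; rewrite mcharlierE mulr_sumr; apply: eq_bigr => -[i /= ni] _.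
rewrite poch_oppn -bin_ffact natrM.
have -> : poch (- x) i = (-1) ^+ i * falling x i.
  rewrite /poch /falling -[i in (-1) ^+ i]card_ord -prodrN.
  by apply: eq_bigr => t _; ring.
have -> : (- a) ^+ n = (- a) ^+ (n - i) * (- a) ^+ i by rewrite -exprD subnK.
have -> : (- a^-1) ^+ i = ((- a) ^+ i)^-1 by rewrite -exprVn invrN.
have s1 : (-1) ^+ i * (-1) ^+ i = 1 :> F by rewrite -expr2 sqrr_sign.
rewrite -[LHS]mul1r -[X in X * _ = _]s1; field.
by rewrite factf_neq0 expf_neq0// oppr_eq0.
Qed.

End MonicCharlier.

(** * The candidate for R_n and its polynomial factor *)

Section PolynomialFactor.
Variables (R : realType) (N' : nat) (a : R) (lam : nat) (mu : 'I_N'.+1 -> R).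
Hypothesis mu_gt0 : forall j, 0 < mu j.
Local Notation C := R[i].
Local Notation N := N'.+1.
Local Notation ac := (a%:C : C).
Local Notation A := (matA mu).
Local Notation L0 := (matL0 a mu).

(** The scaling which turns the matrices of the theorem into Toeplitz matrices:
    conjugating by diag(mu) multiplies the entry (j, k) by this ratio. *)
Definition mu_ratio (j k : 'I_N) : C := (mu j / mu k)%:C.

Lemma mu_neq0 j : mu j != 0. Proof. by rewrite gt_eqF. Qed.

Lemma muC_neq0 j : (mu j)%:C != 0 :> C.
Proof. by rewrite fmorph_eq0 mu_neq0. Qed.

Lemma mu_ratioM j k l : mu_ratio j k * mu_ratio k l = mu_ratio j l.
Proof. by rewrite /mu_ratio -rmorphM /=; congr (_%:C); field;
  rewrite !mu_neq0. Qed.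

Lemma mu_ratioxx j : mu_ratio j j = 1.
Proof. by rewrite /mu_ratio divff// mu_neq0. Qed.

Lemma matA_exp i (j k : 'I_N) :
  (A ^+ i) j k = if j == (k + i)%N :> nat then mu_ratio j k else 0.
Proof.
elim: i j k => [|i IHi] j k.
  by rewrite expr0 mxE addn0; rewrite val_eqE; case: eqVneq => [->|//];
    rewrite mu_ratioxx.
rewrite exprSr mxE; case: ifP => [/eqP jk|jk].
  have lk : (k.+1 < N)%N by apply: leq_ltn_trans (ltn_ord j); rewrite jk; lia.
  rewrite (bigD1 (Ordinal lk)) //= big1 ?addr0 => [|l lnk].
    by rewrite IHi mxE /= jk eqxx addSnnS eqxx mu_ratioM.
  by rewrite [A l k]mxE ifF ?mulr0//; apply: contraNF lnk; rewrite -val_eqE.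
rewrite big1// => l _; rewrite IHi mxE.
case: eqP => jl; case: eqP => lk; rewrite ?(mulr0, mul0r)//.
by move/eqP: jk; rewrite jl lk; lia.
Qed.

Lemma unipow_entry z (j k : 'I_N) :
  unipow A z j k = if (k <= j)%N then mu_ratio j k * gbinom z (j - k) else 0.
Proof.
rewrite /unipow summxE.
under eq_bigr => i _ do rewrite mxE matA_exp.
case: leqP => [kj|jk].
  have ljk : (j - k < N)%N by have := ltn_ord j; lia.
  rewrite (bigD1 (Ordinal ljk)) //= subnKC// eqxx big1 ?addr0 1?mulrC// => i ik.
  case: eqP; rewrite ?mulr0// => jki; case/eqP: ik.
  by apply: val_inj => /=; lia.
by rewrite big1// => i _; rewrite ifF ?mulr0//; apply/negbTE; lia.
Qed.

Lemma unipow0 : unipow A 0 = 1.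
Proof. by rewrite -[0]/(0%:R) unipow_nat expr0. Qed.

Lemma unipowS z : unipow A (z + 1) = (1 + A) * unipow A z.
Proof.
rewrite mulrDl mul1r {3}/unipow mulr_sumr big_ord_recr /= -scalerAr -exprS.
rewrite matA_nilpotent scaler0 addr0 /unipow big_ord_recl [in RHS]big_ord_recl.
rewrite -addrA; congr (_ + _); first by rewrite /gbinom !big_ord0.
rewrite -big_split; apply: eq_bigr => i _ /=.
by rewrite /bump /= add1n -scalerAr -exprS gbinom_pascal scalerDl addrC.
Qed.

Lemma unipowD z n : unipow A (z + n%:R) = (1 + A) ^+ n * unipow A z.
Proof.
elim: n => [|n IHn]; first by rewrite addr0 expr0 mul1r.
by rewrite -natr1 addrA unipowS IHn exprS mulrA.
Qed.

Lemma one_plus_A_unit n : (1 + A) ^+ n \in unitmx.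
Proof.
rewrite -[_ \in _]/(_ \is a GRing.unit) unitrX// -[_ \is a _]/(_ \in unitmx).
suff /mulmx1_unit[] : (1 + A) *m unipow A (-1) = 1%:M by [].
by rewrite mulmxE -unipowS addNr unipow0.
Qed.

Lemma L0_unit : L0 \in unitmx.
Proof.
rewrite unitmxE det_trig; last first.
  by apply/is_trig_mxP => j k jk; rewrite mxE leqNgt jk.
rewrite unitfE; apply/prodf_neq0 => j _.
by rewrite mxE leqnn subnn expr0 fact0 divr1 mulr1 -/(mu_ratio j j) mu_ratioxx
  oner_neq0.
Qed.

Lemma sum_window (f : nat -> C) (j k : 'I_N) : (k <= j)%N ->
  \sum_(l < N | (k <= l <= j)%N) f (l - k)%N = \sum_(i < (j - k).+1) f i.
Proof.
move=> kj; have jN := ltn_ord j.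
rewrite -(big_mkord (fun l => (k <= l <= j)%N) (fun l => f (l - k)%N)).
rewrite (@big_cat_nat _ _ _ k) /=; [|lia..].
rewrite [X in X + _]big_nat_cond big_pred0 ?add0r; last by move=> l /=; lia.
rewrite (@big_cat_nat _ _ _ j.+1) /=; [|lia..].
rewrite [X in _ + X]big_nat_cond [X in _ + X]big_pred0 ?addr0;
  last by move=> l /=; lia.
rewrite -{1}[k : nat]add0n big_addn -(big_mkord predT f) subSn//.
rewrite big_nat_cond [RHS]big_nat_cond; apply: eq_big => [i|i _];
  first by rewrite /=; lia.
by rewrite addnK.
Qed.

(** L_0 (I + A)^y = exp (- a A) (I + A)^y, and C_p(y) / p! is the coefficient of
    w^p in exp (- a w) (1 + w)^y. *)
Lemma L0_unipow y (j k : 'I_N) :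
  (L0 *m unipow A y) j k =
  if (k <= j)%N then mu_ratio j k * (mcharlier ac (j - k) y / (j - k)`!%:R) else
    0.
Proof.
rewrite mxE.
under eq_bigr => l _ do rewrite unipow_entry mxE.
case: leqP => [kj|jk]; last first.
  rewrite big1// => l _; case: (leqP l j) => lj; rewrite ?mul0r//.
  by rewrite ifF ?mulr0//; apply/negbTE; lia.
rewrite mcharlierE mulr_suml mulr_sumr.
transitivity (\sum_(l < N | (k <= l <= j)%N)
   mu_ratio j k * ('C(j - k, l - k)%:R * (- ac) ^+ (j - k - (l - k)) *
     falling y (l - k) / (j - k)`!%:R)).
  rewrite [RHS]big_mkcond; apply: eq_bigr => l _.
  case: (leqP l j) => lj; rewrite ?andbF ?mul0r//.
  case: (leqP k l) => kl; rewrite ?mulr0//=.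
  rewrite rmorphM /= -/(mu_ratio j l) -(mu_ratioM j l k) gbinomE.
  rewrite rmorphM /= fmorphV rmorphXn rmorphN /= rmorph_nat.
  have -> : (j - k - (l - k) = j - l)%N by lia.
  have := @bin_fact (j - k) (l - k) ltac:(lia).
  have -> : (j - k - (l - k) = j - l)%N by lia.
  move=> <-; rewrite !natrM; field.
  rewrite !factf_neq0 pnatr_eq0 -lt0n bin_gt0 !muC_neq0 !andbT /=; lia.
pose f (m : nat) := mu_ratio j k * ('C(j - k, m)%:R * (- ac) ^+ (j - k - m) *
     falling y m / (j - k)`!%:R).
by rewrite (sum_window f).
Qed.

(** The explicit candidate for R_n. For n + j < k the truncated index n + j - k
    is harmless because the coefficient vanishes ([charlier_coef_eq0]). *)
Definition charlier_mx n x : 'M[C]_N :=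
  \matrix_(j, k) (mu_ratio j k * (charlier_coef _ n lam (N' - j) j k *
                   mcharlier ac (n + j - k) x)).

(** Multiplication by this matrix on the left moves row j + q to row j with
    weight gamma_jq; rows past the last one are cut off, which is the condition
    q <= b in [charlier_coef]. *)
Definition weighted_shift n q : 'M[C]_N :=
  \matrix_(j, l) if l == (j + q)%N :> nat
                 then mu_ratio j l * shift_coef _ n lam (N' - j) j q else 0.

Definition falling_poly i : {poly C} := \prod_(t < i) ('X - (t%:R)%:P).

Lemma falling_polyE i x : (falling_poly i).[x] = falling x i.
Proof.
by rewrite /falling_poly horner_prod; apply: eq_bigr => t _; rewrite !hornerE.
Qed.

Lemma size_falling_poly i : size (falling_poly i) = i.+1.
Proof. by rewrite size_prod_XsubC -[X in size X]/(index_enum _) /index_enum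
  -enumT size_enum_ord. Qed.

Lemma monic_falling_poly i : falling_poly i \is monic.
Proof. exact: monic_prod_XsubC. Qed.

Definition poly_scale_mx (B : 'M[C]_N) (p : {poly C}) : {poly 'M[C]_N} :=
  B%:P * map_poly (@scalar_mx C N) p.

Lemma horner_poly_scale_mx B p x : (poly_scale_mx B p).[x%:M] = p.[x] *: B.
Proof. by rewrite /poly_scale_mx hornerCM horner_map /=
  -mulmxE mul_mx_scalar. Qed.

Lemma coef_poly_scale_mx B p n : (poly_scale_mx B p)`_n = p`_n *: B.
Proof. by rewrite /poly_scale_mx coefCM coef_map /= -mulmxE mul_mx_scalar. Qed.

Definition factor_coef n q i : 'M[C]_N :=
  ((- ac) ^+ (n - q - i) / ((n - q - i)`! * i`!)%:R) *:
  (weighted_shift n q *m (L0 *m invmx ((1 + A) ^+ (i + lam)))).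

(** The polynomial K(x) (I + A)^(-lam-x) of the header. The falling factorials
    are the coefficients in the addition rule [mcharlierD], and (I +
    A)^(-(i+lam)) is what remains of (I + A)^(x-i) once (I + A)^(x+lam) has been
    split off. *)
Definition polynomial_factor n : {poly 'M[C]_N} :=
  \sum_(q < n.+1) \sum_(i < (n - q).+1) poly_scale_mx (factor_coef n q i)
    (falling_poly i).

Lemma weighted_shift0 n : weighted_shift n 0 = n`!%:R%:M.
Proof.
apply/matrixP => j l; rewrite !mxE addn0 [RHS]mulrb val_eqE eq_sym.
case: eqP => // ->; rewrite mu_ratioxx mul1r /shift_coef bin0 !subn0 expr0 mul1r
  !natrM mul1r.
by field; rewrite !factf_neq0.
Qed.

(** Only q = 0 and i = n contribute to the degree n, and the weighted shift by 0
    is the scalar n!. *)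
Lemma coef_polynomial_factor n : (polynomial_factor n)`_n =
  L0 *m invmx ((1 + A) ^+ (n + lam)).
Proof.
have szf i : (i < n)%N -> (falling_poly i)`_n = 0.
  by move=> i_n; rewrite nth_default// size_falling_poly.
rewrite /polynomial_factor coef_sum big_ord_recl /=
  [X in _ + X]big1 ?addr0 => [|q _]; last first.
  rewrite coef_sum big1// => i _; rewrite coef_poly_scale_mx szf ?scale0r//.
  by have := ltn_ord q; have := ltn_ord i; rewrite /bump /=; lia.
rewrite subn0 coef_sum big_ord_recr /= [X in X + _]big1 ?add0r => [|i _];
  last first.
  by rewrite coef_poly_scale_mx szf ?scale0r.
rewrite coef_poly_scale_mx.
have -> : (falling_poly n)`_n = 1.
  by have /monicP := monic_falling_poly n; rewrite lead_coefE size_falling_poly.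
rewrite scale1r /factor_coef weighted_shift0 subn0 subnn expr0 fact0 mul1n
  mul_scalar_mx.
by rewrite scalerA mul1r mulVf ?scale1r// factf_neq0.
Qed.

Lemma size_polynomial_factor n : (size (polynomial_factor n) <= n.+1)%N.
Proof.
apply/leq_sizeP => m nm; rewrite /polynomial_factor coef_sum big1// => q _.
rewrite coef_sum big1// => i _; rewrite coef_poly_scale_mx nth_default
  ?scale0r//.
by rewrite size_falling_poly; have := ltn_ord i; lia.
Qed.

Lemma polynomial_factor_unipow n x :
  (polynomial_factor n).[x%:M] *m unipow A (lam%:R + x) = charlier_mx n x.
Proof.
have step q : (q <= n)%N ->
  (\sum_(i < (n - q).+1) poly_scale_mx (factor_coef n q i)
    (falling_poly i)).[x%:M] *m
    unipow A (lam%:R + x) =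
  weighted_shift n q *m \matrix_(j, k) if (k <= j)%N then
     mu_ratio j k * (mcharlier ac (n - q + (j - k)) x /
       ((n - q)`! * (j - k)`!)%:R)
     else 0.
  move=> qn; rewrite horner_sum mulmx_suml.
  transitivity (weighted_shift n q *m \sum_(i < (n - q).+1)
    ((- ac) ^+ (n - q - i) / ((n - q - i)`! * i`!)%:R * falling x i) *:
      (L0 *m unipow A (x - i%:R))).
    rewrite mulmx_sumr; apply: eq_bigr => i _.
    rewrite horner_poly_scale_mx falling_polyE /factor_coef scalerA -scalemxAl
      -scalemxAr.
    rewrite [X in X *: _]mulrC; congr (_ *: _).
    rewrite -!mulmxA; congr (_ *m (_ *m _)).
    have -> : lam%:R + x = x - i%:R + (i + lam)%:R by rewrite natrD; ring.
    by rewrite unipowD -mulmxE mulKmx// one_plus_A_unit.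
  congr (_ *m _); apply/matrixP => j k; rewrite summxE [RHS]mxE.
  under eq_bigr => i _ do rewrite mxE L0_unipow.
  case: ifP => kj; last by rewrite big1// => i _; rewrite mulr0.
  rewrite mcharlierD mulr_suml mulr_sumr; apply: eq_bigr => i _.
  have := @bin_fact (n - q) i ltac:(have := ltn_ord i; lia).
  move=> <-; rewrite !natrM; field.
  by rewrite !factf_neq0 pnatr_eq0 -lt0n bin_gt0 ?muC_neq0 ?andbT /=; have :=
    ltn_ord i; lia.
rewrite /polynomial_factor horner_sum mulmx_suml; apply/matrixP => j k.
rewrite summxE [RHS]mxE /charlier_coef mulr_suml mulr_sumr [RHS]big_mkcond /=.
apply: eq_bigr => q _; rewrite step ?leq_ord// mxE.
under eq_bigr => l _ do rewrite !mxE.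
case: (leqP q (N' - j)%N) => qj /=; last first.
  rewrite big1// => l _; rewrite ifF ?mul0r//.
  by apply/negbTE; have := ltn_ord l; lia.
have jqN : (j + q < N)%N by have := ltn_ord j; lia.
rewrite (bigD1 (Ordinal jqN)) //= eqxx [X in _ + X]big1 ?addr0 => [|l lj];
  last first.
  by rewrite ifF ?mul0r//; apply: contraNF lj; rewrite -val_eqE.
case: leqP => kjq; last by rewrite mulr0.
rewrite -(mu_ratioM j (Ordinal jqN) k) /=.
have -> : (n - q + (j + q - k) = n + j - k)%N by have := ltn_ord q; lia.
by ring.
Qed.

End PolynomialFactor.

(** * Sums against the Poisson weight *)

Section PoissonSum.
Variables (R : realType) (a : R).
Hypothesis a_gt0 : 0 < a.
Local Notation C := R[i].

Definition poisson (x : nat) : C := (a ^+ x / x`!%:R)%:C.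

Definition poisson_sum (f : nat -> C) : C :=
  limn (series (fun x => poisson x * f x : C^o)).

(** Series against the Poisson weight converge for these functions, which makes
    [poisson_sum] linear on them. *)
Definition polyfun (f : nat -> C) := exists p : {poly C}, forall x, f x =
  p.[x%:R].

Lemma polyfun_eq f g : f =1 g -> polyfun f -> polyfun g.
Proof. by move=> fg [p fp]; exists p => x; rewrite -fg. Qed.

Lemma polyfun_horner (p : {poly C}) : polyfun (fun x => p.[x%:R]).
Proof. by exists p. Qed.

Lemma polyfun_cst c : polyfun (fun=> c).
Proof. by exists c%:P => x; rewrite hornerC. Qed.

Lemma polyfunD f g : polyfun f -> polyfun g -> polyfun (fun x => f x + g x).
Proof. by move=> [p fp] [q gq]; exists (p + q) => x; rewrite hornerD fp gq. Qed.

Lemma polyfunM f g : polyfun f -> polyfun g -> polyfun (fun x => f x * g x).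
Proof. by move=> [p fp] [q gq]; exists (p * q) => x; rewrite hornerM fp gq. Qed.

Lemma polyfun_sum (I : Type) (r : seq I) (P : pred I) (f : I -> nat -> C) :
  (forall i, polyfun (f i)) -> polyfun (fun x => \sum_(i <- r | P i) f i x).
Proof.
move=> pf; elim: r => [|i r IHr].
  by apply: (polyfun_eq _ (polyfun_cst 0)) => x; rewrite big_nil.
have := polyfunD (pf i) IHr; case Pi : (P i) => IHi.
  by apply: (polyfun_eq _ IHi) => x; rewrite big_cons Pi.
by apply: (polyfun_eq _ IHr) => x; rewrite big_cons Pi.
Qed.

Lemma polyfun_conj f : polyfun f -> polyfun (fun x => Num.conj (f x)).
Proof.
move=> [p fp]; exists (map_poly Num.conj p) => x.
by rewrite fp -[in RHS](conjC_nat C x) horner_map.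
Qed.

Lemma polyfunS f : polyfun f -> polyfun (fun x => f x.+1).
Proof.
move=> [p fp]; exists (p \Po ('X + 1%:P)) => x.
by rewrite fp horner_comp !hornerE natr1.
Qed.

Lemma cvg_real_complex (u : nat -> R) :
  cvgn u -> cvgn (fun n => (u n)%:C : C^o).
Proof.
move=> /cvg_ex[l ul]; apply/cvg_ex; exists (l%:C : C^o).
apply/cvgrPdist_lt => e e0.
have ee : e = (complex.Re e)%:C by rewrite RRe_real// gtr0_real.
have re0 : 0 < complex.Re e by rewrite -ltcR -ee.
move/cvgrPdist_lt : ul => /(_ _ re0); apply: filterS => n.
rewrite -rmorphB /= [in X in _ -> X]ee.
rewrite normc_def /= expr0n addr0 sqrtr_sqr.
by rewrite ltcR.
Qed.

(** Since x^m <= (2^x)^m, the terms are dominated by those of exp(2^m a). *)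
Lemma is_cvg_real_poisson m :
  cvgn (series (fun x : nat => a ^+ x / x`!%:R * x%:R ^+ m)).
Proof.
apply: (@series_le_cvg _ _ (exp_coeff (2 ^+ m * a))).
- by move=> x; rewrite mulr_ge0 ?exprn_ge0 ?divr_ge0 ?exprn_ge0// ltW.
- by move=> x; rewrite exp_coeff_ge0// mulr_ge0 ?exprn_ge0// ltW.
- move=> x; rewrite /exp_coeff /= exprMn mulrAC ler_wpM2r ?invr_ge0//.
  rewrite mulrC ler_wpM2r ?exprn_ge0 ?(ltW a_gt0)// -exprM mulnC exprM.
  by rewrite lerXn2r ?nnegrE ?exprn_ge0// -natrX ler_nat ltnW// ltn_expl.
- exact: is_cvg_series_exp_coeff.
Qed.

Lemma is_cvg_poisson f : polyfun f ->
  cvgn (series (fun x => poisson x * f x : C^o)).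
Proof.
move=> [p fp].
suff H m : cvgn (series (fun x => poisson x * (x%:R ^+ m * p.[x%:R]) : C^o)).
  have -> : (fun x => poisson x * f x : C^o) =
      (fun x => poisson x * (x%:R ^+ 0 * p.[x%:R])).
    by apply/funext => x; rewrite expr0 mul1r fp.
  exact: H.
elim/poly_ind: p {f fp} m => [|p c IHp] m.
  rewrite (_ : (fun _ => _) = 0 *: (fun=> 0 : C^o)).
    by apply: is_cvg_seriesZ; rewrite (_ : series _ = fun=> 0);
      [exact: is_cvg_cst|
     apply/funext => n; rewrite /series /= big1].
  by apply/funext => x; rewrite horner0 !mulr0 scale0r.
rewrite (_ : (fun _ => _) = (fun x => poisson x * (x%:R ^+ m.+1 * p.[x%:R]) :
  C^o) +
    c *: (fun x => (a ^+ x / x`!%:R * x%:R ^+ m)%:C : C^o)).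
  apply: is_cvg_seriesD; first exact: IHp.
  apply: is_cvg_seriesZ.
  rewrite (_ : series _ =
    fun n => (series (fun x : nat => a ^+ x / x`!%:R * x%:R ^+ m) n)%:C);
      last first.
    by apply/funext => n; rewrite /series /= rmorph_sum.
  exact/cvg_real_complex/is_cvg_real_poisson.
apply/funext => x; rewrite /poisson !hornerE /=.
have e : (a ^+ x / x`!%:R * x%:R ^+ m)%:C =
  (a ^+ x / x`!%:R)%:C * x%:R ^+ m :> C.
  by rewrite [LHS]rmorphM [X in _ * X = _]rmorphXn /= rmorph_nat.
rewrite [X in _ = _ + X](_ : _ = c * (a ^+ x / x`!%:R * x%:R ^+ m)%:C)//.
by rewrite e exprS; ring.
Qed.

Lemma poisson_sumD f g : polyfun f -> polyfun g ->
  poisson_sum (fun x => f x + g x) = poisson_sum f + poisson_sum g.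
Proof.
move=> /is_cvg_poisson cf /is_cvg_poisson cg.
rewrite /poisson_sum.
have e : (fun x => poisson x * (f x + g x) : C^o) =
  (fun x => poisson x * f x : C^o) + (fun x => poisson x * g x : C^o).
  by apply/funext => x; rewrite mulrDr.
rewrite e.
rewrite (lim_seriesD cf cg).
by [].
Qed.

Lemma poisson_sumZ c f : polyfun f -> poisson_sum (fun x => c * f x) =
  c * poisson_sum f.
Proof.
move=> /is_cvg_poisson cf.
have e : (fun x => poisson x * (c * f x) : C^o) =
   c *: (fun x => poisson x * f x : C^o).
  by apply/funext => x; rewrite mulrCA.
rewrite /poisson_sum e.
rewrite (lim_seriesZ c cf).
by [].
Qed.

Lemma eq_poisson_sum f g : f =1 g -> poisson_sum f = poisson_sum g.
Proof. by move=> /funext ->. Qed.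

Lemma poisson_sum0 : poisson_sum (fun=> 0) = 0.
Proof.
transitivity (poisson_sum (fun=> 0 * (0 : C)));
  last by rewrite poisson_sumZ ?mul0r//; exact: polyfun_cst.
by apply: eq_poisson_sum => x; rewrite mul0r.
Qed.

Lemma poisson_sum_big (I : Type) (r : seq I) (P : pred I) (f : I -> nat -> C) :
  (forall i, polyfun (f i)) ->
  poisson_sum (fun x => \sum_(i <- r | P i) f i x) =
    \sum_(i <- r | P i) poisson_sum (f i).
Proof.
move=> pf; elim: r => [|i r IHr].
  by rewrite big_nil -[RHS]poisson_sum0; apply: eq_poisson_sum => x;
    rewrite big_nil.
rewrite big_cons; case Pi : (P i).
  rewrite -IHr -poisson_sumD//; last exact: polyfun_sum.
  by apply: eq_poisson_sum => x; rewrite big_cons Pi.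
by rewrite -IHr; apply: eq_poisson_sum => x; rewrite big_cons Pi.
Qed.

Lemma poissonS x : poisson x.+1 * x.+1%:R = a%:C * poisson x.
Proof.
rewrite /poisson -(rmorph_nat (real_complex R)) -!rmorphM /=; congr (_%:C).
by rewrite exprS factS natrM; field;
  rewrite factf_neq0 [1 + _]addrC natr1 pnatr_eq0.
Qed.

Lemma poisson_sum_shift f : polyfun f -> poisson_sum (fun x => x%:R * f x.-1) =
  a%:C * poisson_sum f.
Proof.
move=> pf; rewrite -poisson_sumZ// /poisson_sum.
have H : (series (fun x => poisson x * (x%:R * f x.-1) : C^o) @ \oo -->
    limn (series (fun x => poisson x * (a%:C * f x) : C^o)))%classic.
  rewrite -cvg_shiftS.
  have -> : (fun n => series (fun x => poisson x * (x%:R * f x.-1) : C^o) n.+1)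
    =
      series (fun x => poisson x * (a%:C * f x) : C^o).
    apply/funext => n; rewrite /series /= big_nat_recl// mul0r mulr0 add0r.
    by apply: eq_bigr => i _; rewrite /= mulrA poissonS mulrCA mulrA.
  by apply: is_cvg_poisson; apply: polyfunM => //; exact: polyfun_cst.
exact: (cvg_lim (@norm_hausdorff _ C^o) H).
Qed.

(** A single positive term would bound all later partial sums from below. *)
Lemma poisson_sum_ge0_eq0 f : polyfun f -> (forall x, 0 <= f x) ->
  poisson_sum f = 0 ->
  forall x, f x = 0.
Proof.
move=> pf f0 sf0 x; apply/eqP/negPn/negP => fx0.
have w0 y : 0 < poisson y by rewrite ltcR divr_gt0 ?exprn_gt0// ltr0n fact_gt0.
have fx : 0 < poisson x * f x by rewrite mulr_gt0// lt0r fx0 f0.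
have : (series (fun x => poisson x * f x : C^o) @ \oo --> (0 : C^o))%classic.
  by rewrite -sf0; exact: is_cvg_poisson.
move/cvgrPdist_lt => /(_ _ fx) [n _ /(_ (maxn n x.+1))].
rewrite /= leq_maxl => /(_ isT); rewrite sub0r normrN.
have s0 m : 0 <= series (fun x => poisson x * f x : C^o) m.
  by apply: sumr_ge0 => i _; rewrite mulr_ge0// ltW.
rewrite ger0_norm// => /lt_geF/negP; apply.
rewrite /series /= (bigD1_seq x) ?iota_uniq ?mem_index_iota ?leq_maxr//=.
by rewrite lerDl sumr_ge0// => i _; rewrite mulr_ge0// ltW.
Qed.

Lemma polyfun_falling c r : polyfun (fun x => falling (x%:R + c) r).
Proof.
elim: r => [|r IHr].
  by apply: (polyfun_eq _ (polyfun_cst 1)) => x; rewrite /falling big_ord0.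
have pl : polyfun (fun x => x%:R + (c - r%:R)).
  by exists ('X + (c - r%:R)%:P) => x; rewrite !hornerE.
by apply: (polyfun_eq _ (polyfunM IHr pl)) => x; rewrite fallingS addrA.
Qed.

Lemma polyfun_bin c r : polyfun (fun x => 'C(x + c, r)%:R).
Proof.
apply: (polyfun_eq _ (polyfunM (polyfun_falling c%:R r)
  (polyfun_cst r`!%:R^-1))).
by move=> x; rewrite -gbinomE -natrD gbinom_nat//; exact: pchar_num.
Qed.

Lemma polyfun_mcharlier m : polyfun (fun x => mcharlier a%:C m x%:R).
Proof.
have := polyfun_sum (index_enum 'I_m.+1) xpredT (fun i : 'I_m.+1 => polyfunM
  (polyfun_cst ('C(m, i)%:R * (- a%:C) ^+ (m - i))) (polyfun_falling 0 i)).
apply: polyfun_eq => x; rewrite mcharlierE.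
by apply: eq_bigr => i _; rewrite addr0.
Qed.

(** Summation by parts: shifting the index by one in the series turns
    multiplication by x into multiplication by a, and so moves the raising
    operator onto g as a forward difference. *)
Lemma poisson_sum_mcharlierS m g : polyfun g ->
  poisson_sum (fun x => mcharlier a%:C m.+1 x%:R * g x) =
  a%:C * poisson_sum (fun x => mcharlier a%:C m x%:R * (g x.+1 - g x)).
Proof.
move=> pg; have pm := polyfun_mcharlier m; have pgS := polyfunS pg.
have pmg := polyfunM pm pg; have pmgS := polyfunM pm pgS.
have pid : polyfun (fun x => x%:R) by exists 'X => x; rewrite hornerX.
transitivity (poisson_sum (fun x => x%:R *
  (mcharlier a%:C m x.-1%:R * g x.-1.+1)) +
              - a%:C * poisson_sum (fun x => mcharlier a%:C m x%:R * g x)).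
  rewrite -poisson_sumZ// -poisson_sumD.
  - apply: eq_poisson_sum => -[|x].
      by rewrite /mcharlier /= /charlier_raise !mul0r; ring.
    by rewrite /mcharlier /= /charlier_raise -natr1 addrK; ring.
  - have pS := polyfunM (polyfun_mcharlier m.+1) pg.
    have := polyfunD pS (polyfunM (polyfun_cst a%:C) pmg).
    apply: polyfun_eq => -[|x]; rewrite /mcharlier /= /charlier_raise ?mul0r.
      by ring.
    by rewrite -natr1 addrK; ring.
  - exact/polyfunM/pmg/polyfun_cst.
rewrite (poisson_sum_shift pmgS) mulNr -mulrBr; congr (_ * _).
rewrite -mulN1r -poisson_sumZ// -poisson_sumD//;
  last exact/polyfunM/pmg/polyfun_cst.
by apply: eq_poisson_sum => x; ring.
Qed.

Lemma poisson_sum_mcharlier_bin m c r :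
  poisson_sum (fun x => mcharlier a%:C m x%:R * 'C(x + c, r)%:R) =
  if (m <= r)%N then a%:C ^+ m * poisson_sum (fun x => 'C(x + c, r - m)%:R) else
    0.
Proof.
elim: m r => [|m IHm] r.
  by rewrite leq0n expr0 mul1r subn0; apply: eq_poisson_sum => x; rewrite mul1r.
rewrite poisson_sum_mcharlierS; last exact: polyfun_bin.
case: r => [|r].
  rewrite -[RHS](mulr0 a%:C) -poisson_sum0; congr (_ * _);
    apply: eq_poisson_sum => x.
  by rewrite !bin0 subrr mulr0.
transitivity (a%:C * poisson_sum
  (fun x => mcharlier a%:C m x%:R * 'C(x + c, r)%:R)).
  congr (_ * _); apply: eq_poisson_sum => x.
  by rewrite addSn binS natrD addrAC subrr add0r.
by rewrite IHm ltnS subSS; case: ifP => _; rewrite ?mulr0// exprS mulrA.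
Qed.

End PoissonSum.

(** * Uniqueness of monic orthogonal matrix polynomials *)

Section Uniqueness.
Local Open Scope sesquilinear_scope.
Variables (R : realType) (N' : nat) (a : R).
Hypothesis a_gt0 : 0 < a.
Local Notation C := R[i].
Local Notation N := N'.+1.

Definition polymx (M : nat -> 'M[C]_N) :=
  forall i j, polyfun (fun x => M x i j).

Lemma polymx_cst M : polymx (fun=> M).
Proof. by move=> i j; exact: polyfun_cst. Qed.

Lemma polymxM X Y : polymx X -> polymx Y -> polymx (fun x => X x *m Y x).
Proof.
move=> pX pY i j.
have := polyfun_sum (index_enum 'I_N) xpredT
  (fun k => polyfunM (pX i k) (pY k j)).
by apply: polyfun_eq => x; rewrite mxE.
Qed.

Lemma polymx_adj X : polymx X -> polymx (fun x => (X x)^t*).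
Proof.
by move=> pX i j; apply: (polyfun_eq _ (polyfun_conj (pX j i))) => x;
  rewrite !mxE.
Qed.

Definition entry_poly (G : {poly 'M[C]_N}) i j : {poly C} :=
  \poly_(k < size G) G`_k i j.

Lemma horner_entry_poly G i j x : (entry_poly G i j).[x] = G.[x%:M] i j.
Proof.
rewrite horner_poly horner_coef summxE; apply: eq_bigr => k _.
by rewrite -rmorphXn -mulmxE mul_mx_scalar mxE mulrC.
Qed.

Lemma polymx_horner (G : {poly 'M[C]_N}) : polymx (fun x => G.[x%:R%:M]).
Proof. by move=> i j; exists (entry_poly G i j) => x;
  rewrite horner_entry_poly. Qed.

Lemma adjM (X Y : 'M[C]_N) : (X *m Y)^t* = Y^t* *m X^t*.
Proof. by rewrite trmx_mul map_mxM. Qed.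

Lemma adjD (X Y : 'M[C]_N) : (X + Y)^t* = X^t* + Y^t*.
Proof. by rewrite linearD map_mxD. Qed.

Variables (B : nat -> 'M[C]_N) (d : 'rV[C]_N).
Hypotheses (pB : polymx B) (uB : forall x, B x \in unitmx).
Hypothesis d_gt0 : forall k, 0 < d 0 k.

Local Notation Z x := (B x *m diag_mx d *m (B x)^t*).
Local Notation W := (fun x => poisson a x *: Z x).

(** The entry (i, j) of the inner product for the weight (a^x / x!) B(x) D B(x)'
    with D diagonal. *)
Definition poisson_form (P Q : {poly 'M[C]_N}) (i j : 'I_N) : C :=
  poisson_sum a (fun x => (P.[x%:R%:M] *m Z x *m (Q.[x%:R%:M])^t*) i j).

Lemma inner_poisson_form P Q i j : inner W P Q i j = poisson_form P Q i j.
Proof.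
rewrite mxE /poisson_form /poisson_sum.
have e : (fun x => (P.[x%:R%:M] *m W x *m (Q.[x%:R%:M])^t*) i j : C^o) =
  (fun x => poisson a x * (P.[x%:R%:M] *m Z x *m (Q.[x%:R%:M])^t*) i j : C^o).
  by apply/funext => x; rewrite -scalemxAr -scalemxAl mxE.
by rewrite e.
Qed.

Lemma polymx_weight (P Q : {poly 'M[C]_N}) :
  polymx (fun x => P.[x%:R%:M] *m Z x *m (Q.[x%:R%:M])^t*).
Proof.
apply: polymxM; last exact/polymx_adj/polymx_horner.
apply: polymxM; first exact: polymx_horner.
apply: polymxM; last exact: polymx_adj.
by apply: polymxM => //; exact: polymx_cst.
Qed.

Lemma poisson_formDr P Q1 Q2 i j : poisson_form P (Q1 + Q2) i j =
  poisson_form P Q1 i j + poisson_form P Q2 i j.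
Proof.
apply: etrans (poisson_sumD a_gt0 (polymx_weight P Q1 i j)
  (polymx_weight P Q2 i j)).
by apply: eq_poisson_sum => x; rewrite hornerD adjD mulmxDr mxE.
Qed.

Lemma poisson_formBl P1 P2 Q i j : poisson_form (P1 - P2) Q i j =
  poisson_form P1 Q i j - poisson_form P2 Q i j.
Proof.
have p1 := polymx_weight P1 Q i j; have p2 := polymx_weight P2 Q i j.
apply: etrans _ (congr1 (+%R (poisson_form P1 Q i j))
  (etrans (poisson_sumZ a_gt0 (-1) p2) (mulN1r _))).
apply: etrans (poisson_sumD a_gt0 p1 (polyfunM (polyfun_cst (-1)) p2)).
by apply: eq_poisson_sum => x; rewrite hornerD hornerN !mulmxBl mxE
  [X in _ + X]mxE mulN1r.
Qed.

Lemma poisson_formMr P c Q i j :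
  poisson_form P (c%:P * Q) i j = \sum_k Num.conj (c j k) * poisson_form P Q i
    k.
Proof.
transitivity (poisson_sum a (fun x => \sum_k Num.conj (c j k) *
    (P.[x%:R%:M] *m Z x *m (Q.[x%:R%:M])^t*) i k)).
  apply: eq_poisson_sum => x; rewrite hornerCM -mulmxE adjM mulmxA mxE.
  by apply: eq_bigr => k _; rewrite mulrC !mxE.
apply: etrans (poisson_sum_big a_gt0 _ _ _) _.
  by move=> k; apply: polyfunM; [exact: polyfun_cst|exact: polymx_weight].
by apply: eq_bigr => k _; apply: (poisson_sumZ a_gt0 _ (polymx_weight P Q i k)).
Qed.

Lemma poisson_form0r P i j : poisson_form P 0 i j = 0.
Proof.
rewrite /poisson_form -[RHS](poisson_sum0 a_gt0); apply: eq_poisson_sum => x.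
by rewrite horner0 trmx0 map_mx0 mulmx0 mxE.
Qed.

(** Induction on the degree: subtracting from G its coefficient of degree m
    times P m lowers the degree, since P m is monic. *)
Lemma orthogonal_lower (P : nat -> {poly 'M[C]_N}) n (G : {poly 'M[C]_N}) :
  monic_orthogonal W P -> (size G <= n)%N -> forall i j,
    poisson_form (P n) G i j = 0.
Proof.
move=> [mP oP].
suff H m (G' : {poly 'M[C]_N}) : (m <= n)%N -> (size G' <= m)%N ->
  forall i j, poisson_form (P n) G' i j = 0 by exact: H.
elim: m G' => [|m IHm] {}G mn.
  by rewrite leqn0 size_poly_eq0 => /eqP -> i j; exact: poisson_form0r.
move=> sG i j; pose G' := G - (G`_m)%:P * P m.
have -> : poisson_form (P n) G i j =
    poisson_form (P n) G' i j + poisson_form (P n) ((G`_m)%:P * P m) i j.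
  by rewrite -poisson_formDr subrK.
have -> : poisson_form (P n) ((G`_m)%:P * P m) i j = 0.
  rewrite poisson_formMr big1// => k _.
  by rewrite -inner_poisson_form oP ?gtn_eqF// mxE mulr0.
suff sG' : (size G' <= m)%N by rewrite (IHm _ (ltnW mn) sG') addr0.
have [/monicP lP sP] := mP m.
apply/leq_sizeP => k; rewrite leq_eqVlt => /orP[/eqP <-|mk].
  by move: lP; rewrite lead_coefE sP coefB coefCM => ->; rewrite mulr1 subrr.
by rewrite coefB coefCM [(P m)`_k]nth_default ?sP// mulr0 nth_default ?subr0//
  (leq_trans sG).
Qed.

(** Each diagonal entry is a series of nonnegative terms, weighted sums of the
    squared moduli of the entries of D(x) B(x). They all vanish, hence so does D
    at every natural number. *)
Lemma poisson_form_definite (D : {poly 'M[C]_N}) :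
  (forall i, poisson_form D D i i = 0) -> D = 0.
Proof.
move=> D0; suff De (x : nat) : D.[x%:R%:M] = 0.
  have ep i j : entry_poly D i j = 0.
    apply/eqP/negPn/negP => e0.
    have := max_poly_roots e0 (rs :=
      [seq (k%:R : C) | k <- iota 0 (size (entry_poly D i j))]).
    rewrite size_map size_iota ltnn => H; suff: false by []; apply: H.
      apply/allP => _ /mapP[k _ ->]; rewrite rootE horner_entry_poly De mxE//.
    by rewrite map_inj_uniq ?iota_uniq// => k l /eqP; rewrite eqr_nat => /eqP.
  apply/polyP => k; rewrite coef0; apply/matrixP => i j; rewrite [RHS]mxE.
  have := congr1 (fun p : {poly C} => p`_k) (ep i j); rewrite coef_poly coef0.
  by case: ltnP => // kD _; rewrite nth_default ?mxE.
have VE y i : (D.[y%:R%:M] *m Z y *m (D.[y%:R%:M])^t*) i i =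
    \sum_k d 0 k * ((D.[y%:R%:M] *m B y) i k * Num.conj
      ((D.[y%:R%:M] *m B y) i k)).
  have -> : D.[y%:R%:M] *m Z y *m (D.[y%:R%:M])^t* =
      (D.[y%:R%:M] *m B y) *m diag_mx d *m (D.[y%:R%:M] *m B y)^t*.
    by rewrite adjM !mulmxA.
  rewrite mxE; apply: eq_bigr => k _.
  by rewrite mul_mx_diag !mxE mulrAC mulrC.
have V0 y i k : 0 <= d 0 k * ((D.[y%:R%:M] *m B y) i k * Num.conj
  ((D.[y%:R%:M] *m B y) i k)).
  by rewrite mulr_ge0 ?mul_conjC_ge0// ltW.
suff Vx : D.[x%:R%:M] *m B x = 0.
  by rewrite -(mulmxK (uB x) D.[x%:R%:M]) Vx mul0mx.
apply/matrixP => i k; rewrite [RHS]mxE.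
have s0 : poisson_sum a (fun y => (D.[y%:R%:M] *m Z y *m (D.[y%:R%:M])^t*) i i)
  = 0.
  exact: D0.
have ge0 y : 0 <= (D.[y%:R%:M] *m Z y *m (D.[y%:R%:M])^t*) i i.
  by rewrite VE sumr_ge0.
have /eqP := poisson_sum_ge0_eq0 a_gt0 (polymx_weight D D i i) ge0 s0 x;
  rewrite VE.
rewrite psumr_eq0 => [/allP /(_ k)|k' _]; last exact: V0.
rewrite mem_index_enum => /(_ isT) /=.
by rewrite mulf_eq0 gt_eqF//= mul_conjC_eq0 => /eqP.
Qed.

(** The difference of P n and Q has degree less than n, so it is orthogonal to
    both of them, and therefore to itself. *)
Lemma monic_orthogonal_unique P n (Q : {poly 'M[C]_N}) :
  monic_orthogonal W P -> (size Q <= n.+1)%N -> Q`_n = 1 ->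
  (forall i j (g : {poly C}), (size g <= n)%N ->
     poisson_sum a (fun x => (Q.[x%:R%:M] *m Z x) i j * g.[x%:R]) = 0) ->
  P n = Q.
Proof.
move=> oP sQ Qn Q0; have [/monicP lP sP] := oP.1 n.
set D := P n - Q.
have sD : (size D <= n)%N.
  apply/leq_sizeP => k; rewrite leq_eqVlt => /orP[/eqP <-|nk].
    by move: lP; rewrite lead_coefE sP coefB Qn => ->; rewrite subrr.
  by rewrite coefB !nth_default ?subr0 ?sP// (leq_trans sQ).
apply/eqP; rewrite -subr_eq0 -/D; apply/eqP/poisson_form_definite.
move=> j; rewrite poisson_formBl orthogonal_lower// sub0r; apply/eqP;
  rewrite oppr_eq0; apply/eqP.
pose g k := map_poly Num.conj (entry_poly D j k).
have gE k (x : nat) : (g k).[x%:R] = Num.conj (D.[x%:R%:M] j k).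
  by rewrite -[in LHS](conjC_nat C x) horner_map /= horner_entry_poly.
have sg k : (size (g k) <= n)%N.
  by rewrite (leq_trans (size_poly _ _))// (leq_trans (size_poly _ _)).
transitivity (poisson_sum a (fun x => \sum_k (Q.[x%:R%:M] *m Z x) j k *
  (g k).[x%:R])).
  by apply: eq_poisson_sum => x; rewrite mxE; apply: eq_bigr => k _;
    rewrite gE !mxE.
have pQZ : polymx (fun x => Q.[x%:R%:M] *m Z x).
  apply: polymxM; first exact: polymx_horner.
  apply: polymxM; last exact: polymx_adj.
  by apply: polymxM => //; exact: polymx_cst.
rewrite poisson_sum_big//; last by move=> k; apply: polyfunM => //;
  exact: polyfun_horner.
by rewrite big1// => k _; apply: Q0.
Qed.

End Uniqueness.


(** * Orthogonality of the candidate *)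

Section Orthogonality.
Local Open Scope sesquilinear_scope.
Variables (R : realType) (N' : nat) (a : R) (lam : nat) (mu : 'I_N'.+1 -> R).
Hypotheses (a_gt0 : 0 < a) (muP : mu_spec a mu).
Local Notation C := R[i].
Local Notation N := N'.+1.
Local Notation ac := (a%:C : C).
Local Notation A := (matA mu).
Local Notation L0 := (matL0 a mu).
Local Notation rho := (mu_ratio mu).
Let mu_gt0 : forall j, 0 < mu j := muP.1.

Definition weight_root (x : nat) : 'M[C]_N := (1 + A) ^+ (x + lam).

Definition weight_diag : 'rV[C]_N := \row_(k < N) (delta a lam k.+1)%:C.

Lemma adj_exp (X : 'M[C]_N) n : (X ^+ n)^t* = (X^t*) ^+ n.
Proof.
elim: n => [|n IHn]; first by rewrite !expr0 trmx1 map_mx1.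
by rewrite exprS exprSr -!mulmxE adjM IHn.
Qed.

Lemma weightE : weight a lam mu =
  fun x => poisson a x *: (weight_root x *m diag_mx weight_diag *m
    (weight_root x)^t*).
Proof.
have adj1 : (1 + A)^t* = 1%:M + A^t* by rewrite adjD trmx1 map_mx1.
by apply/funext => x; rewrite /weight /weight_root adj_exp adj1.
Qed.

Lemma mu_ratio_ge0 j k : 0 <= rho j k.
Proof. by rewrite /mu_ratio lecR divr_ge0 ?ltW. Qed.

Lemma weight_root_entry x j k :
  weight_root x j k = if (k <= j)%N then rho j k * 'C(x + lam, j - k)%:R else 0.
Proof.
have -> : weight_root x = unipow A (x + lam)%:R by rewrite unipow_nat.
by rewrite unipow_entry// gbinom_nat//; exact: pchar_num.
Qed.

Lemma conj_weight_root x j k : Num.conj (weight_root x j k) = weight_root x j k.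
Proof.
apply/conj_Creal/ger0_real; rewrite weight_root_entry.
by case: ifP => _ //; rewrite mulr_ge0 ?mu_ratio_ge0 ?ler0n.
Qed.

Lemma polymx_weight_root : polymx weight_root.
Proof.
move=> j k.
have h : polyfun (fun x =>
    if (k <= j)%N then rho j k * 'C(x + lam, j - k)%:R else 0 : C).
  case: (k <= j)%N; last exact: polyfun_cst.
  exact: (polyfunM (polyfun_cst _) (polyfun_bin _ _ _)).
by apply: (polyfun_eq _ h) => x; rewrite weight_root_entry.
Qed.

Lemma weight_root_unit x : weight_root x \in unitmx.
Proof. exact: one_plus_A_unit. Qed.

Lemma weight_diag_gt0 k : 0 < weight_diag 0 k.
Proof.
by rewrite mxE ltcR mulr_gt0 ?exprn_gt0 ?divr_gt0 ?ltr0n ?fact_gt0.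
Qed.

(** The polynomial (x+lam+1) ... (x+lam+m). Its values merge with binom(x+lam,
    s) into a multiple of binom(x+lam+m, s+m), see [bin_test_poly]: the lower
    index grows together with the upper one for all s at once. *)
Definition test_poly m : {poly C} :=
  \prod_(t < m) ('X - (- (lam + t.+1)%:R)%:P).

Lemma test_polyE m (x : nat) : (test_poly m).[x%:R] = ((x + lam + m) ^_ m)%:R.
Proof.
rewrite /test_poly horner_prod; elim: m => [|m IHm].
  by rewrite big_ord0 ffactn0.
rewrite big_ord_recr /= IHm !hornerE opprK [(x + lam + m.+1)%N]addnS ffactSS.
rewrite natrM mulrC; congr (_ * _).
by rewrite -natrD; congr (_%:R); lia.
Qed.

Lemma poisson_sum_low_degree (h : nat -> C) n (g : {poly C}) : polyfun h ->
  (forall m, (m < n)%N -> poisson_sum a (fun x => h x * (test_poly m).[x%:R]) =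
    0) ->
  (size g <= n)%N -> poisson_sum a (fun x => h x * g.[x%:R]) = 0.
Proof.
move=> ph h0.
suff H m : (m <= n)%N -> (size g <= m)%N ->
  poisson_sum a (fun x => h x * g.[x%:R]) = 0.
  exact: H.
elim: m g => [|m IHm] g mn.
  rewrite leqn0 size_poly_eq0 => /eqP ->; rewrite -[RHS](poisson_sum0 a_gt0).
  by apply: eq_poisson_sum => x; rewrite horner0 mulr0.
move=> sg; pose g' := g - g`_m *: test_poly m.
have szt : size (test_poly m) = m.+1.
  by rewrite size_prod_XsubC -[X in size X]/(index_enum _) /index_enum -enumT
    size_enum_ord.
have sg' : (size g' <= m)%N.
  apply/leq_sizeP => k; rewrite leq_eqVlt => /orP[/eqP <-|mk].
    have /monicP := monic_prod_XsubC (index_enum 'I_m) predT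
      (fun t : 'I_m => - (lam + t.+1)%:R : C).
    by rewrite lead_coefE -/(test_poly m) szt coefB coefZ => ->;
      rewrite mulr1 subrr.
  rewrite coefB coefZ [g`_k]nth_default ?(leq_trans sg)//.
  by rewrite [(test_poly m)`_k]nth_default ?szt// mulr0 subr0.
have pg (p : {poly C}) : polyfun (fun x => h x * p.[x%:R]).
  exact: (polyfunM ph (polyfun_horner _)).
have e : poisson_sum a (fun x => h x * g.[x%:R]) =
    poisson_sum a (fun x => h x * g'.[x%:R] + g`_m *
      (h x * (test_poly m).[x%:R])).
  by apply: eq_poisson_sum => x; rewrite /g' hornerD hornerN hornerZ; ring.
rewrite e; apply: etrans (poisson_sumD a_gt0 (pg g')
  (polyfunM (polyfun_cst _) (pg _))) _.
by rewrite (poisson_sumZ a_gt0 _ (pg _)) h0// mulr0 addr0 (IHm g' (ltnW mn)).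
Qed.

Lemma bin_test_poly m s (x : nat) :
  'C(x + lam, s)%:R * (test_poly m).[x%:R] =
  'C(x + (lam + m), s + m)%:R * (s + m)`!%:R / s`!%:R.
Proof.
rewrite test_polyE; apply: (canRL (mulfK (factf_neq0 _ _))).
rewrite mulrAC -!natrM !bin_ffact addnA; congr (_%:R).
have [sx|xs] := leqP s (x + lam); last first.
  by rewrite [((x + lam) ^_ s)%N]ffact_small// mul0n ffact_small// ltn_add2r.
apply/eqP; rewrite -(eqn_pmul2r (fact_gt0 (x + lam - s))); apply/eqP.
rewrite mulnAC ffact_fact// -(subnDr m) ffact_fact ?leq_add2r//.
by have := @ffact_fact (x + lam + m) m (leq_addl _ _); rewrite addnK mulnC.
Qed.

(** The powers of a that come from the squares of the mu ratios and from
    [poisson_sum_mcharlier_bin] combine to a power which is independent of i. *)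
Lemma mu_ratio_mulX (j k i : 'I_N) n : (i <= n + j)%N ->
  rho j i * rho k i * ac ^+ (n + j - i) =
  rho k j * (ac ^+ n * (N' - i)`!%:R / (N' - j)`!%:R).
Proof.
move=> inj; rewrite -(mu_ratioM mu_gt0 k j i) mulrCA -!mulrA; congr (_ * _).
have an0 : a != 0 by rewrite gt_eqF.
have -> : rho j i * (rho j i * ac ^+ (n + j - i)) =
    ((mu j / mu i) ^+ 2 * a ^+ (n + j - i))%:C.
  by rewrite /mu_ratio !rmorphM !rmorphXn /= mulrA -expr2 -rmorphM.
rewrite muP.2 !subSS.
have -> : a ^+ (n + j - i) = a ^+ (n + j) / a ^+ i.
  by apply: (canRL (mulfK _)); rewrite ?expf_neq0// -exprD subnK.
rewrite expfzDr// -exprnN -exprnP !exprD.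
have -> : a ^+ i / a ^+ j * ((N' - i)`!%:R / (N' - j)`!%:R) *
   (a ^+ n * a ^+ j / a ^+ i) = a ^+ n * ((N' - i)`!%:R / (N' - j)`!%:R).
  by field; rewrite !expf_neq0//= factf_neq0.
by rewrite !rmorphM !rmorphXn /= fmorphV !rmorph_nat mulrA.
Qed.

(** By [poisson_sum_mcharlier_bin] every term of the entry (j, k) is a multiple
    of the series S below, or all of them vanish when k + m < n + j. The sum of
    the multipliers is the one of [charlier_coef_orth]. *)
Lemma charlier_mx_orthogonal n j k (g : {poly C}) : (size g <= n)%N ->
  poisson_sum a (fun x => (charlier_mx a lam mu n x%:R *m diag_mx weight_diag *m
    (weight_root x)^t*) j k * g.[x%:R]) = 0.
Proof.
have hE x : (charlier_mx a lam mu n x%:R *m diag_mx weight_diag *m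
  (weight_root x)^t*) j k =
    \sum_(i < N | (i <= k)%N) rho j i * rho k i *
      (charlier_coef C n lam (N' - j) j i * weight_diag 0 i) *
      (mcharlier ac (n + j - i) x%:R * 'C(x + lam, k - i)%:R).
  rewrite mxE [RHS]big_mkcond; apply: eq_bigr => i _.
  rewrite mul_mx_diag [(weight_root x)^t* i k]mxE [in X in _ * X = _]mxE
    conj_weight_root.
  rewrite weight_root_entry [_ j i]mxE [charlier_mx _ _ _ _ _ _ _]mxE.
  by case: ifP => _; rewrite ?mulr0//; ring.
have pmb m c r : polyfun (fun x => mcharlier ac m x%:R * 'C(x + c, r)%:R).
  exact: polyfunM (polyfun_mcharlier a m) (polyfun_bin R c r).
apply: poisson_sum_low_degree => [|m mn].
  apply: (polyfun_eq (fun x => esym (hE x))).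
  by apply: polyfun_sum => i; apply: (polyfunM (polyfun_cst _) (pmb _ _ _)).
transitivity (poisson_sum a (fun x => \sum_(i < N | (i <= k)%N)
   (rho j i * rho k i * (charlier_coef C n lam (N' - j) j i * weight_diag 0 i) *
     ((k - i + m)`!%:R / (k - i)`!%:R)) *
   (mcharlier ac (n + j - i) x%:R * 'C(x + (lam + m), k - i + m)%:R))).
  apply: eq_poisson_sum => x; rewrite hE mulr_suml; apply: eq_bigr => i _.
  rewrite -!mulrA bin_test_poly; ring.
apply: etrans (poisson_sum_big a_gt0 _ _ _) _.
  by move=> i; apply: polyfunM (polyfun_cst _) (pmb _ _ _).
have [njkm|kmnj] := leqP (n + j) (k + m); last first.
  rewrite big1// => i ik; apply: etrans (poisson_sumZ a_gt0 _ (pmb _ _ _)) _.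
  by rewrite poisson_sum_mcharlier_bin// ifF ?mulr0//; apply/negbTE; lia.
pose S := poisson_sum a (fun x => ('C(x + (lam + m), k + m - (n + j))%:R : C)).
pose K := rho k j * (ac ^+ n / (N' - j)`!%:R) * ((a / 2) ^+ lam)%:C * S.
transitivity (K * \sum_(i < k.+1) charlier_coef C n lam (N' - j) j i *
   ((lam + i)`! * (N' - j + j - i)`! * (k - i + m)`!)%:R /
     (i`! * (k - i)`!)%:R);
  last first.
  by rewrite charlier_coef_orth ?mulr0//; have := ltn_ord j; have := ltn_ord k;
    lia.
rewrite (big_ord_widen N (fun i : nat => charlier_coef C n lam (N' - j) j i *
   ((lam + i)`! * (N' - j + j - i)`! * (k - i + m)`!)%:R /
     (i`! * (k - i)`!)%:R))//.
rewrite mulr_sumr; apply: eq_bigr => i ik.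
apply: etrans (poisson_sumZ a_gt0 _ (pmb _ _ _)) _.
have [inj|nji] := leqP i (n + j); last by rewrite charlier_coef_eq0//
  !(mul0r, mulr0).
rewrite poisson_sum_mcharlier_bin// ifT; last by lia.
have -> : (k - i + m - (n + j - i) = k + m - (n + j))%N by lia.
rewrite -/S ?subnK; last by have := ltn_ord j; lia.
have -> : weight_diag 0 i = ((a / 2) ^+ lam)%:C * ((lam + i)`!%:R / i`!%:R).
  by rewrite mxE /delta addnS !subn1 rmorphM /= rmorphM /= fmorphV !rmorph_nat.
have e := mu_ratio_mulX k inj.
transitivity ((rho j i * rho k i * ac ^+ (n + j - i)) * ((a / 2) ^+ lam)%:C * S
  *
  (charlier_coef C n lam (N' - j) j i *
   ((lam + i)`!%:R * (k - i + m)`!%:R / (i`!%:R * (k - i)`!%:R)))).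
  move: (rho j i) (rho k i) => r1 r2.
  by field; rewrite !factf_neq0.
apply: etrans (congr1 (fun z => z * _ * S * _) e) _.
rewrite /K !natrM; move: (rho k j) => r.
by field; rewrite !factf_neq0.
Qed.

(** The candidate for P_n: the polynomial factor divided by its leading
    coefficient. *)
Definition explicit_orthogonal n : {poly 'M[C]_N} :=
  (invmx (L0 *m invmx ((1 + A) ^+ (n + lam))))%:P * polynomial_factor a lam mu
    n.

Lemma leading_unit n : L0 *m invmx ((1 + A) ^+ (n + lam)) \in unitmx.
Proof. by rewrite unitmx_mul L0_unit//= unitmx_inv one_plus_A_unit. Qed.

Lemma monic_orthogonal_eq (P : nat -> {poly 'M[C]_N}) n :
  monic_orthogonal (weight a lam mu) P -> P n = explicit_orthogonal n.
Proof.
rewrite weightE => oP.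
apply: (monic_orthogonal_unique a_gt0 polymx_weight_root weight_root_unit
  weight_diag_gt0 oP).
- rewrite /explicit_orthogonal; apply/leq_sizeP => m nm;
  rewrite coefCM nth_default ?mulr0//.
  by rewrite (leq_trans _ nm)// size_polynomial_factor.
- by rewrite /explicit_orthogonal coefCM coef_polynomial_factor//
  -mulmxE mulVmx// leading_unit.
move=> i j g sg.
pose M := invmx (L0 *m invmx ((1 + A) ^+ (n + lam))).
pose H x := charlier_mx a lam mu n x%:R *m diag_mx weight_diag *m
  (weight_root x)^t*.
have PE x : (explicit_orthogonal n).[x%:R%:M] *m
  (weight_root x *m diag_mx weight_diag *m (weight_root x)^t*) =
    M *m H x.
  rewrite /explicit_orthogonal hornerCM -mulmxE -/M /H
    -polynomial_factor_unipow// !mulmxA.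
  by rewrite -natrD addnC unipow_nat.
have pH : polymx H.
  apply: polymxM; last exact/polymx_adj/polymx_weight_root.
  apply: polymxM; last exact: polymx_cst.
  move=> k l; apply: (polyfun_eq _ (polyfunM (polyfun_cst
    (rho k l * charlier_coef C n lam (N' - k) k l))
      (polyfun_mcharlier a (n + k - l)))).
  by move=> x; rewrite mxE mulrA.
transitivity (poisson_sum a (fun x => \sum_l M i l * (H x l j * g.[x%:R]))).
  by apply: eq_poisson_sum => x; rewrite PE mxE mulr_suml;
    apply: eq_bigr => l _; rewrite mulrA.
have pHg l : polyfun (fun x => H x l j * g.[x%:R]).
  exact: polyfunM (pH _ _) (polyfun_horner _).
apply: etrans (poisson_sum_big a_gt0 _ _ _) _.
  by move=> l; apply: polyfunM (polyfun_cst _) (pHg _).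
apply: big1 => l _; apply: etrans (poisson_sumZ a_gt0 _ (pHg _)) _.
by rewrite charlier_mx_orthogonal ?mulr0.
Qed.

Lemma matR_charlier_mx (P : nat -> {poly 'M[C]_N}) n x :
  monic_orthogonal (weight a lam mu) P -> matR a lam mu P n x =
    charlier_mx a lam mu n x.
Proof.
move=> oP; rewrite /matR (monic_orthogonal_eq n oP) /explicit_orthogonal
  hornerCM -mulmxE.
by rewrite mulKVmx ?leading_unit// polynomial_factor_unipow.
Qed.

Lemma charlier_coef_real_complex n b j k : (charlier_coef R n lam b j k)%:C =
  charlier_coef C n lam b j k.
Proof.
rewrite /charlier_coef rmorph_sum; apply: eq_bigr => q _.
rewrite /shift_coef rmorphM /= fmorphV rmorph_nat rmorphM /= fmorphV rmorph_nat.
by rewrite rmorphM /= rmorph_nat rmorphXn rmorphN1.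
Qed.

Lemma charlier_mx_entry n x (j k : 'I_N) :
  charlier_mx a lam mu n x j k =
  if (k <= n + j)%N
  then (xi_of a N lam j.+1 k.+1 n)%:C * charlier ac (n + j - k) x else 0.
Proof.
rewrite mxE; case: leqP => [knj|njk]; last by rewrite charlier_coef_eq0//
  mul0r mulr0.
have jN : (j <= N')%N by have := ltn_ord j.
have kN : (k <= N')%N by have := ltn_ord k.
rewrite xi_of_charlier_coef// (sqrt_powR_mu_ratio a_gt0 muP knj).
rewrite mcharlier_charlier; last by rewrite fmorph_eq0 gt_eqF.
rewrite -charlier_coef_real_complex.
have -> : (-1) ^+ (n + j + k) = (-1) ^+ (n + j - k) :> R.
  by rewrite -signr_odd oddD -oddB// signr_odd.
have -> : (- ac) ^+ (n + j - k) = ((-1) ^+ (n + j - k) * a ^+ (n + j - k))%:C.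
  by rewrite -exprMn mulN1r rmorphXn /= rmorphN.
rewrite !mulrA; congr (_ * _); rewrite /mu_ratio -!rmorphM /=; congr (_%:C);
  ring.
Qed.

End Orthogonality.

Theorem theorem7p9 (R : realType) (N' : nat) (a : R) (lam : nat)
    (mu : 'I_N'.+1 -> R) (P : nat -> {poly 'M[R[i]]_N'.+1}) :
  let N := N'.+1 in
  0 < a ->
  mu_spec a mu ->
  monic_orthogonal (weight a lam mu) P ->
  exists xi : nat -> nat -> nat -> R,
    (forall (n : nat) (j0 k0 : 'I_N), let j := j0.+1 in let k := k0.+1 in
       forall x : R[i],
         matR a lam mu P n x j0 k0 =
         if (k <= n + j)%N
         then (xi j k n)%:C * charlier a%:C (n + j - k) x
         else 0) /\
    (forall j k n : nat,
       (1 <= j <= N)%N -> (1 <= k <= N)%N -> (k <= n + j)%N ->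
       xi j k n =
         frakX a N j k n lam *
         (if (N <= n + j)%N
          then poch (1 - N%:R) (k - 1) *
               pFq [:: 1 - k%:R; j%:R - N%:R; n%:R + lam%:R + 1]
                   [:: lam%:R + 1; 1 - N%:R] 1
          else poch (1 - n%:R - j%:R) (k - 1) *
               pFq [:: 1 - k%:R; - n%:R; N%:R - j%:R + lam%:R + 1]
                   [:: lam%:R + 1; 1 - n%:R - j%:R] 1)
       /\
       xi j k n =
         frakX a N j k n lam *
         (if (N <= n + j)%N
          then poch (1 - N%:R) (k - 1) *
               dual_hahn (k - 1) (N%:R - j%:R)
                         lam%:R (n%:R + j%:R - N%:R) (N - 1)
          else poch (1 - n%:R - j%:R) (k - 1) *
               dual_hahn (k - 1) n%:R
                         lam%:R (N%:R - (n%:R + j%:R)) (n + j - 1))).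
Proof.
move=> N a_gt0 muP oP; exists (xi_of a N lam); split.
  move=> n j0 k0 j k x; rewrite (matR_charlier_mx a_gt0 muP _ _ oP).
  by rewrite charlier_mx_entry// /j /k addnS ltnS subSS.
by move=> j k n jN kN knj; split=> //; exact: xi_of_dual_hahn.
Qed.
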